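(* For each $c\in\mathbb{N}$, the class of $c$-incompressible perfect trees which are not members of any deep $\Pi^0_1$ class is comeager in the space of $c$-incompressible pruned trees (with the prefix topology).
   Context: $2^\omega$ is Cantor space, $2^{<\omega}$ the set of finite binary strings, $2^n$ the set of $n$-bit strings, $2^{\leq n}=\bigcup_{i\leq n}2^i$. $K$ is prefix-free Kolmogorov complexity. A tree is a nonempty set $T\subseteq 2^{<\omega}$ that is downward-closed under the prefix relation $\preceq$. $T$ is pruned if it has no $\preceq$-maximal element; perfect if each string in $T$ has at least two $\preceq$-incomparable strict extensions in $T$; $c$-incompressible if $\sup_{\sigma\in T}(|\sigma|-K(\sigma))<c$. Let $\mathcal{T}$ be the set of pruned trees. The prefix topology on $\mathcal{T}$ is generated by the basic open sets $\{T\in\mathcal{T}: F=T\cap 2^{\leq n}\text{ for some }n\}$, where $F$ ranges over finite trees; the space of $c$-incompressible pruned trees has the subspace topology. Deep classes: let $\mathbf{m}$ be a universal (multiplicatively optimal) lower semicomputable discrete semimeasure on $2^{<\omega}$ (e.g. $\mathbf{m}(\sigma)=2^{-K(\sigma)}$). For a $\Pi^0_1$ class $P\subseteq 2^\omega$ let $P_n$ be the set of $n$-bit prefixes of members of $P$ and $\mathbf{m}(P_n)=\sum_{\sigma\in P_n}\mathbf{m}(\sigma)$. $P$ is deep if there is a computable order (nondecreasing unbounded function) $g:\mathbb{N}\to\mathbb{N}$ with $\mathbf{m}(P_n)\leq 2^{-g(n)}$ for all $n$. Coding of trees: fix an effective injective coding of the finite tree-prefixes $T\cap 2^{\leq n}$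 ($T\in\mathcal{T}$) by binary strings that preserves the prefix relations, with the code of $T\cap 2^{\leq n}$ having length $p_n$ for a computable function $n\mapsto p_n$. This induces an effective homeomorphism of $\mathcal{T}$ onto an effectively closed subspace of $2^\omega$, and trees are identified with their codes; so ''$T$ is a member of a $\Pi^0_1$ class $P$'' means that the code of $T$ is in $P\subseteq 2^\omega$. *)

(* Defs.v *)
From HB Require Import structures.
From mathcomp Require Import all_boot all_order all_algebra.
From mathcomp Require Import all_classical all_reals all_analysis.

Set Implicit Arguments.
Unset Strict Implicit.
Unset Printing Implicit Defensive.

Import Order.TTheory GRing.Theory Num.Theory.
Import numFieldNormedType.Exports.
Local Open Scope classical_set_scope.
Local Open Scope ring_scope.

Inductive mu_code : Type :=
| Zero
| Succ
| Proj of nat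
| Comp of mu_code & seq mu_code
| Prec of mu_code & mu_code
| Mu of mu_code.

(* [mu_eval c v y]: the partial function denoted by [c] is defined on the argument
   list [v], with value [y].  Arities are not tracked by the types: a missing
   argument reads as 0 and a superfluous one is ignored by the basic functions.
   The first argument is the recursion variable of [Prec] and the search
   variable of [Mu]. *)
Fixpoint mu_eval (c : mu_code) (v : seq nat) (y : nat) {struct c} : Prop :=
  match c with
  | Zero => y = 0%N
  | Succ => y = (nth 0%N v 0).+1
  | Proj i => y = nth 0%N v i
  | Comp f gs =>
      exists ws : seq nat,
        (fix eval_all (gs : seq mu_code) (ws : seq nat) {struct gs} : Prop :=
           match gs, ws with
           | [::], [::] => True
           | g :: gs', w :: ws' => mu_eval g v w /\ eval_all gs' ws'
           | _, _ => False
           end) gs ws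
        /\ mu_eval f ws y
  | Prec f g =>
      (fix rec (n y : nat) {struct n} : Prop :=
         match n with
         | 0%N => mu_eval f (behead v) y
         | n'.+1 => exists z, rec n' z /\ mu_eval g (n' :: z :: behead v) y
         end) (nth 0%N v 0) y
  | Mu f =>
      mu_eval f (y :: v) 0%N
      /\ (forall i, (i < y)%N -> exists z, mu_eval f (i :: v) z.+1)
  end.

Definition computable1 (f : nat -> nat) : Prop :=
  exists c, forall x, mu_eval c [:: x] (f x).

Definition computable2 (f : nat -> nat -> nat) : Prop :=
  exists c, forall x y, mu_eval c [:: x; y] (f x y).

(* Bijective base-2 numeration, least significant digit first: a bijection
   between binary strings and natural numbers. *)
Definition strn (s : seq bool) : nat :=
  foldr (fun (b : bool) n => (n.*2 + b.+1)%N) 0%N s.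

Definition ce (W : set (seq bool)) : Prop :=
  exists c, forall s, W s <-> exists y, mu_eval c [:: strn s] y.

Definition runs (M : mu_code) (p s : seq bool) : Prop :=
  mu_eval M [:: strn p] (strn s).

Definition prefix_free (M : mu_code) : Prop :=
  forall p q s t, runs M p s -> runs M q t -> prefix p q -> p = q.

Definition optimal_prefix_free (U : mu_code) : Prop :=
  prefix_free U /\
  forall M, prefix_free M -> exists d : nat, forall p s, runs M p s ->
    exists2 q, runs U q s & (size q <= size p + d)%N.

(* The infimum is a minimum, unless no program outputs [s], where it is +oo;
   the latter does not occur if [U] is optimal. *)
Definition K (R : realType) (U : mu_code) (s : seq bool) : \bar R :=
  ereal_inf [set ((size p)%:R)%:E | p in [set p | runs U p s]].

Definition is_tree (T : set (seq bool)) : Prop :=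
  T !=set0 /\ forall s t, prefix s t -> T t -> T s.

Definition is_pruned (T : set (seq bool)) : Prop :=
  forall s, T s -> exists t, [/\ T t, prefix s t & s <> t].

Definition is_perfect (T : set (seq bool)) : Prop :=
  forall s, T s -> exists t u,
    [/\ T t, T u, prefix s t /\ s <> t, prefix s u /\ s <> u
      & ~~ prefix t u /\ ~~ prefix u t].

Definition is_incompressible (R : realType) (U : mu_code) (c : nat)
    (T : set (seq bool)) : Prop :=
  (ereal_sup [set ((size s)%:R)%:E - K R U s | s in T] < (c%:R)%:E)%E.

Definition trunc_tree (T : set (seq bool)) (n : nat) : set (seq bool) :=
  [set s | T s /\ (size s <= n)%N].

Record pruned_tree : Type := PrunedTree {
  tree_set :> set (seq bool);
  tree_setP : is_tree tree_set;
  tree_pruned : is_pruned tree_set }.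

HB.instance Definition _ := gen_eqMixin pruned_tree.
HB.instance Definition _ := gen_choiceMixin pruned_tree.

HB.instance Definition _ := isSubBaseTopological.Build pruned_tree
  [set F : set (seq bool) | finite_set F /\ is_tree F]
  (fun F => [set T : pruned_tree | exists n, F = trunc_tree T n]).

(* As a type, a set of trees carries the library's subspace topology on
   [set_type]. *)
Definition incompressible_trees (R : realType) (U : mu_code) (c : nat) :
    set pruned_tree :=
  [set T | is_incompressible R U c T].

Definition comeager (X : topologicalType) (B : set X) : Prop :=
  exists O : nat -> set X,
    (forall n, open (O n) /\ dense (O n)) /\ \bigcap_n O n `<=` B.

Definition cprefix (x : cantor_space) (n : nat) : seq bool := mkseq x n.

Definition pi01_class (P : set cantor_space) : Prop :=
  exists2 W, ce W & P = [set x | forall n, ~ W (cprefix x n)].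

Definition lower_semicomputable (R : realType) (m : seq bool -> R) : Prop :=
  exists a b : nat -> nat -> nat,
    [/\ computable2 a, computable2 b
      & forall s,
          let q := fun k => (a (strn s) k)%:R / (b (strn s) k).+1%:R : R in
          nondecreasing_seq q /\ q @ \oo --> m s].

Definition semimeasure (R : realType) (m : seq bool -> R) : Prop :=
  (forall s, 0 <= m s) /\ (\esum_(s in [set: seq bool]) (m s)%:E <= 1)%E.

Definition optimal_semimeasure (R : realType) (m : seq bool -> R) : Prop :=
  [/\ semimeasure m, lower_semicomputable m
    & forall mu : seq bool -> R, semimeasure mu -> lower_semicomputable mu ->
        exists2 C : R, 0 < C & forall s, mu s <= C * m s].

Definition class_prefixes (P : set cantor_space) (n : nat) : set (seq bool) :=
  [set cprefix x n | x in P].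

Definition order_function (g : nat -> nat) : Prop :=
  {homo g : i j / (i <= j)%N} /\ forall k, exists n, (k <= g n)%N.

Definition deep (R : realType) (m : seq bool -> R) (P : set cantor_space) :
    Prop :=
  exists g : nat -> nat, [/\ computable1 g, order_function g
    & forall n, \sum_(s \in class_prefixes P n) m s <= 2 ^- g n].

(* For finite [F], the binary digits of its index are the characteristic
   function of [strn @` F]; an infinite [F] gets the junk value 0. *)
Definition canonical_index (F : set (seq bool)) : nat :=
  \sum_(s \in F) (2 ^ strn s)%N.

(* Only the values of [e] on the finite trees [trunc_tree T n] matter. *)
Definition tree_coding (e : set (seq bool) -> seq bool) : Prop :=
  [/\ exists2 p : nat -> nat, computable1 p
        & forall (T : pruned_tree) n, size (e (trunc_tree T n)) = p n,
      forall (T T' : pruned_tree) n n',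
        e (trunc_tree T n) = e (trunc_tree T' n') ->
        trunc_tree T n = trunc_tree T' n',
      forall (T T' : pruned_tree) n n', (n <= n')%N ->
        trunc_tree T n = trunc_tree T' n ->
        prefix (e (trunc_tree T n)) (e (trunc_tree T' n'))
    & exists2 h : nat -> nat, computable1 h
        & forall (T : pruned_tree) n,
            strn (e (trunc_tree T n)) = h (canonical_index (trunc_tree T n))].

(* The codes of the truncations have unbounded length (by injectivity and
   preservation of prefixes), so [x] is determined by [T]. *)
Definition code_of (e : set (seq bool) -> seq bool) (T : pruned_tree)
    (x : cantor_space) : Prop :=
  forall n, e (trunc_tree T n) = cprefix x (size (e (trunc_tree T n))).

Definition tree_member (e : set (seq bool) -> seq bool) (T : pruned_tree)
    (P : set cantor_space) : Prop :=
  exists2 x, code_of e T x & P x.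

(* Main.v *)
(** If a class of [c]-incompressible sequences through a string [s] is nonempty,
    it has positive measure: otherwise it would be effectively null, and a
    prefix-free machine listing the few strings that survive at a computable
    stage would compress prefixes of its members.  Hence the set of all
    incompressible paths through the leaves of a finite tree [F] is a perfect
    tree, and the [k]-tuples of incompressible paths through the [k] leaves of
    [F] have positive product measure.  If all incompressible trees extending
    [F] belonged to a class [P], then the image of the uniform measure on
    [k]-tuples, restricted to computably many sufficiently sparse levels and
    weighted to be a semimeasure, would give the levels of [P] more weight than
    depth allows.  So perfectness and nonmembership in each of the countably many
    deep classes are dense open conditions. *)

(* Deficiency is only c.e., so the incompressible strings cannot be listed and their measure cannot
   be computed; this shapes both halves. For positive measure, the strings of length $t$ are tested
   against the deficiencies seen by stage $t$. If the claim failed, this decidable overcount would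
   fall to $2^{t-2k}$ at a computable stage for every $k$, and the $2k$ bits saved outweigh the
   $k+1$ bits that announce $k$. For deep classes, the measure pushed forward is the uniform one on
   all tuples, good or bad, and hence computable: the good tuples need not be recognised, it is
   enough that their measure is bounded below by a positive constant at all levels.

   The weights balance two demands. With $w=\lfloor g(p_n)/2\rfloor$, level $n$ receives mass
   $2^{-w-1}$, which exceeds the $2^{-g(p_n)}$ permitted by depth by a factor of order $2^w$; so the
   constants from optimality and from the good tuples are eventually beaten. As $w$ may be constant
   on long stretches, only levels at which it increases are used; there the exponents are distinct
   and the masses sum to at most one. *)
Require Import Defs.
From mathcomp Require Import all_boot all_order all_algebra.
From mathcomp Require Import all_classical all_reals all_analysis.
From mathcomp Require Import zify ring lra finmap.

Set Implicit Arguments.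
Unset Strict Implicit.
Unset Printing Implicit Defensive.

Import Order.TTheory GRing.Theory Num.Theory.
Import numFieldNormedType.Exports.
Local Open Scope classical_set_scope.

(** * Total computable functions *)

Fixpoint mu_evals (gs : seq mu_code) (v ws : seq nat) {struct gs} : Prop :=
  match gs, ws with
  | [::], [::] => True
  | g :: gs', w :: ws' => mu_eval g v w /\ mu_evals gs' v ws'
  | _, _ => False
  end.

Lemma mu_eval_Comp f gs v y :
  mu_eval (Comp f gs) v y <-> exists2 ws, mu_evals gs v ws & mu_eval f ws y.
Proof.
have E hs ws : (fix eval_all (gs : seq mu_code) (ws : seq nat) {struct gs} : Prop :=
   match gs, ws with
   | [::], [::] => True
   | g :: gs', w :: ws' => mu_eval g v w /\ eval_all gs' ws'
   | _, _ => False
   end) hs ws <-> mu_evals hs v ws.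
  elim: hs ws => [|g hs IH] [|w ws] //=.
  by split=> -[Hw /IH Hws].
split=> [/= [ws [/E Hws Hf]]|[ws Hws Hf]]; first by exists ws.
by exists ws; split=> //; apply/E.
Qed.

Fixpoint prec_graph (f g : mu_code) (v : seq nat) (n y : nat) : Prop :=
  match n with
  | 0 => mu_eval f v y
  | n'.+1 => exists2 z, prec_graph f g v n' z & mu_eval g (n' :: z :: v) y
  end.

Lemma mu_eval_Prec f g v y :
  mu_eval (Prec f g) v y <-> prec_graph f g (behead v) (nth 0 v 0) y.
Proof.
rewrite /=; elim: (nth 0 v 0) y => [//|n IH] y /=.
by split=> [[z [/IH Hz Hy]]|[z /IH Hz Hy]]; exists z.
Qed.

(** Arguments come as one list, which makes the closure lemmas uniform in the arity. Only lists of
    length [a] count, so a function may be replaced by any other that agrees on them. *)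
Definition calculable (a : nat) (F : seq nat -> nat) : Prop :=
  exists c, forall v, size v = a -> mu_eval c v (F v).

Lemma eq_calculable a F G :
  (forall v, size v = a -> F v = G v) -> calculable a F -> calculable a G.
Proof. by move=> E [c Hc]; exists c => v sv; rewrite -E //; apply: Hc. Qed.

Lemma calculable_const a n : calculable a (fun=> n).
Proof.
elim: n => [|n [c Hc]]; first by exists Zero.
exists (Comp Succ [:: c]) => v sv; apply/mu_eval_Comp.
by exists [:: n] => //=; split=> //; apply: Hc.
Qed.

Lemma calculable_nth a i : calculable a (fun v => nth 0 v i).
Proof. by exists (Proj i). Qed.

Lemma calculable_comp a b F (G : nat -> seq nat -> nat) :
  calculable b F -> (forall i, i < b -> calculable a (G i)) ->
  calculable a (fun v => F (mkseq (G^~ v) b)).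
Proof.
move=> [c Hc] HG.
suff [gs Hgs] : exists gs, forall v, size v = a ->
    mu_evals gs v [seq G i v | i <- iota 0 b].
  exists (Comp c gs) => v sv; apply/mu_eval_Comp.
  exists (mkseq (G^~ v) b); first exact: Hgs.
  by apply: Hc; rewrite size_mkseq.
have {HG}: forall i, i \in iota 0 b -> calculable a (G i).
  by move=> i; rewrite mem_iota; apply: HG.
elim: (iota 0 b) => [|i s IH] Hs; first by exists [::].
have [gs Hgs] := IH (fun j Hj => Hs j (mem_behead (s := i :: s) Hj)).
have [g Hg] := Hs i (mem_head _ _).
by exists (g :: gs) => v sv /=; split; [exact: Hg | exact: Hgs].
Qed.

Lemma calculable_comp1 a f F :
  calculable 1 (fun w => f (nth 0 w 0)) -> calculable a F ->
  calculable a (fun v => f (F v)).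
Proof. by move=> Hf HF; apply: (calculable_comp (G := fun=> F) Hf). Qed.

Lemma calculable_comp2 a f F G :
  calculable 2 (fun w => f (nth 0 w 0) (nth 0 w 1)) ->
  calculable a F -> calculable a G -> calculable a (fun v => f (F v) (G v)).
Proof.
move=> Hf HF HG.
by apply: (calculable_comp (G := nth G [:: F; G]) Hf) => -[|[|]].
Qed.

Lemma computable1P f : computable1 f <-> calculable 1 (fun v => f (nth 0 v 0)).
Proof.
split=> -[c Hc]; exists c; first by move=> [|x [|]].
by move=> x; apply: Hc [:: x] erefl.
Qed.

Lemma computable2P f :
  computable2 f <-> calculable 2 (fun v => f (nth 0 v 0) (nth 0 v 1)).
Proof.
split=> -[c Hc]; exists c; first by move=> [|x [|y [|]]].
by move=> x y; apply: Hc [:: x; y] erefl.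
Qed.

Lemma calculable_rename a b F (r : nat -> nat) :
  calculable b F -> calculable a (fun v => F (mkseq (fun i => nth 0 v (r i)) b)).
Proof.
move=> HF; apply: (calculable_comp (G := fun i v => nth 0 v (r i)) HF) => i _.
exact: calculable_nth.
Qed.

Lemma nth_eq_mkseq (v : seq nat) (f : nat -> nat) n :
  size v = n -> (forall i, i < n -> f i = nth 0 v i) -> mkseq f n = v.
Proof.
move=> sv Hf; apply: (@eq_from_nth _ 0); rewrite size_mkseq // => i Hi.
by rewrite nth_mkseq // Hf.
Qed.

Lemma calculable_behead a F : calculable a F -> calculable a.+1 (fun w => F (behead w)).
Proof.
move=> /(calculable_rename a.+1 S); apply: eq_calculable => v sv.
congr F; apply: nth_eq_mkseq => [|i _]; first by rewrite size_behead sv.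
by rewrite nth_behead.
Qed.

Lemma calculable_succ a F : calculable a F -> calculable a (fun v => (F v).+1).
Proof. by move=> HF; apply: (calculable_comp1 _ HF); exists Succ. Qed.

Lemma calculable_rec a f g n :
  calculable a f ->
  calculable a.+2 (fun w => g (nth 0 w 0) (nth 0 w 1) (behead (behead w))) ->
  calculable a n ->
  calculable a (fun v => nat_rect (fun=> nat) (f v) (fun i z => g i z v) (n v)).
Proof.
move=> [cf Hf] [cg Hg] Hn.
(* [Prec] recurses on the head of its list; the bound [n v] is obtained afterwards by composing with
   the list [n v :: v]. *)
suff Hr : calculable a.+1 (fun w => nat_rect (fun=> nat) (f (behead w))
    (fun i z => g i z (behead w)) (nth 0 w 0)).
  have HG i : i < a.+1 -> calculable a (if i is j.+1 then nth 0 ^~ j else n).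
    by case: i => [//|i] _; apply: calculable_nth.
  apply: eq_calculable (calculable_comp Hr HG) => v sv.
  have -> : behead (mkseq (fun i => (if i is j.+1 then nth 0 ^~ j else n) v) a.+1) = v.
    apply: (@eq_from_nth _ 0); rewrite size_behead size_mkseq // => i Hi.
    by rewrite nth_behead nth_mkseq // -sv.
  by [].
exists (Prec cf cg) => v sv; apply/mu_eval_Prec.
have sb : size (behead v) = a by rewrite size_behead sv.
elim: (nth 0 v 0) => [|i IH] /=; first exact: Hf.
set z := nat_rect _ _ _ _ in IH *; exists z => //.
by apply: (Hg [:: i, z & behead v]); rewrite /= sb.
Qed.

Lemma calculable_pred a F : calculable a F -> calculable a (fun v => (F v).-1).
Proof.
move=> HF; apply: (calculable_comp1 _ HF).
have := @calculable_rec 1 (fun=> 0) (fun i _ _ => i) (fun w => nth 0 w 0).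
move=> /(_ (calculable_const _ _) (calculable_nth _ _) (calculable_nth _ _)).
by apply: eq_calculable => v _; case: (nth 0 v 0).
Qed.

Lemma calculable_add a F G :
  calculable a F -> calculable a G -> calculable a (fun v => F v + G v).
Proof.
move=> HF HG; have := @calculable_rec a F (fun _ z _ => z.+1) G HF.
move=> /(_ (calculable_succ (calculable_nth _ _)) HG).
by apply: eq_calculable => v _; elim: (G v) => [|n /= ->]; rewrite ?addn0 ?addnS.
Qed.

Lemma calculable_mul a F G :
  calculable a F -> calculable a G -> calculable a (fun v => F v * G v).
Proof.
move=> HF HG; have := @calculable_rec a (fun=> 0) (fun _ z v => z + F v) G.
move=> /(_ (calculable_const _ _)).
move=> /(_ (calculable_add (calculable_nth _ _) (calculable_behead (calculable_behead HF))) HG).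
by apply: eq_calculable => v _; elim: (G v) => [|n /= ->]; rewrite ?muln0 // mulnS addnC.
Qed.

Lemma calculable_sub a F G :
  calculable a F -> calculable a G -> calculable a (fun v => F v - G v).
Proof.
move=> HF HG; have := @calculable_rec a F (fun _ z _ => z.-1) G HF.
move=> /(_ (calculable_pred (calculable_nth _ _)) HG).
by apply: eq_calculable => v _; elim: (G v) => [|n /= ->]; rewrite ?subn0 // subnS.
Qed.

Lemma calculable_exp a F G :
  calculable a F -> calculable a G -> calculable a (fun v => F v ^ G v).
Proof.
move=> HF HG; have := @calculable_rec a (fun=> 1) (fun _ z v => z * F v) G.
move=> /(_ (calculable_const _ _)).
move=> /(_ (calculable_mul (calculable_nth _ _) (calculable_behead (calculable_behead HF))) HG).
by apply: eq_calculable => v _; elim: (G v) => [|n /= ->]; rewrite ?expn0 // expnSr.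
Qed.

(** A recursion step sees the index, the accumulated value and the parameters; this discards the
    accumulated value. *)
Lemma calculable_skip1 a f :
  calculable a.+1 (fun w => f (nth 0 w 0) (behead w)) ->
  calculable a.+2 (fun w => f (nth 0 w 0) (behead (behead w))).
Proof.
move=> /(calculable_rename a.+2 (fun i => if i is j.+1 then j.+2 else 0)).
apply: eq_calculable => -[|x [|y v]] // [sv]; congr f.
rewrite /mkseq /= -[1]addn0 iotaDl -map_comp.
exact: (nth_eq_mkseq sv).
Qed.

Lemma calculable_sum a f n :
  calculable a.+1 (fun w => f (nth 0 w 0) (behead w)) -> calculable a n ->
  calculable a (fun v => \sum_(i < n v) f i v).
Proof.
move=> Hf Hn; have := @calculable_rec a (fun=> 0) (fun i z v => z + f i v) n.
move=> /(_ (calculable_const _ _)) H.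
have {H}/H : calculable a.+2
    (fun w => nth 0 w 1 + f (nth 0 w 0) (behead (behead w))).
  apply: calculable_add; first exact: calculable_nth.
  exact: calculable_skip1.
move=> /(_ Hn); apply: eq_calculable => v _.
elim: (n v) => [|m IH /=]; first by rewrite big_ord0.
by rewrite big_ord_recr /= IH.
Qed.

(** * Decidable predicates and bounded search *)

Definition decidable_on (a : nat) (P : seq nat -> bool) : Prop :=
  calculable a (fun v => P v : nat).

Lemma decidable_leq a F G :
  calculable a F -> calculable a G -> decidable_on a (fun v => F v <= G v).
Proof.
move=> HF HG; have := calculable_sub (calculable_const _ 1) (calculable_sub HF HG).
by apply: eq_calculable => v _; rewrite /leq; case: (F v - G v).
Qed.

Lemma decidable_neg a P : decidable_on a P -> decidable_on a (fun v => ~~ P v).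
Proof.
move=> HP; apply: eq_calculable (calculable_sub (calculable_const _ 1) HP).
by move=> v _; case: (P v).
Qed.

Lemma decidable_and a P Q :
  decidable_on a P -> decidable_on a Q -> decidable_on a (fun v => P v && Q v).
Proof.
move=> HP HQ; apply: eq_calculable (calculable_mul HP HQ) => v _.
by rewrite mulnb.
Qed.

Lemma decidable_eq a F G :
  calculable a F -> calculable a G -> decidable_on a (fun v => F v == G v).
Proof.
move=> HF HG; have := decidable_and (decidable_leq HF HG) (decidable_leq HG HF).
by apply: eq_calculable => v _; rewrite eqn_leq.
Qed.

Lemma decidable_exists a P n :
  decidable_on a.+1 (fun w => P (nth 0 w 0) (behead w)) -> calculable a n ->
  decidable_on a (fun v => [exists i : 'I_(n v), P i v]).
Proof.
move=> HP Hn; have HS := calculable_sum (f := fun i v => P i v : nat) HP Hn.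
have := decidable_leq (calculable_const _ 1) HS; apply: eq_calculable => v _.
congr nat_of_bool; apply/idP/existsP => [|[i Hi]]; last by rewrite (bigD1 i) //= Hi.
apply: contraTP => H; rewrite -leqNgt leqn0; apply/eqP/big1 => i _.
by case E: (P i v) => //; case: H; exists i.
Qed.

Lemma decidable_forall a P n :
  decidable_on a.+1 (fun w => P (nth 0 w 0) (behead w)) -> calculable a n ->
  decidable_on a (fun v => [forall i : 'I_(n v), P i v]).
Proof.
move=> HP Hn.
have := decidable_neg (decidable_exists (P := fun i v => ~~ P i v) (decidable_neg HP) Hn).
apply: eq_calculable => v _; congr nat_of_bool.
by rewrite negb_exists; apply: eq_forallb => i; rewrite negbK.
Qed.

Lemma decidable_or a P Q :
  decidable_on a P -> decidable_on a Q -> decidable_on a (fun v => P v || Q v).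
Proof.
move=> HP HQ; have := decidable_neg (decidable_and (decidable_neg HP) (decidable_neg HQ)).
by apply: eq_calculable => v _; rewrite negb_and !negbK.
Qed.


(** Quotients, bounded searches, string lengths and level numbers are all computed as the count of
    an initial segment. *)
Lemma sum_ltn n k : k <= n -> \sum_(i < n) (i < k : nat) = k.
Proof.
elim: n => [|n IH] Hk; first by rewrite big_ord0; case: k Hk.
rewrite big_ord_recr /=; move: Hk; rewrite leq_eqVlt => /predU1P[->|Hk].
  rewrite ltnSn addn1 (eq_bigr (fun=> 1)) ?sum1_card ?card_ord // => i _.
  by rewrite ltnS ltnW.
by rewrite IH // (ltnNge n) -ltnS Hk addn0.
Qed.

Lemma calculable_div a F G :
  calculable a F -> calculable a G -> calculable a (fun v => F v %/ G v).
Proof.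
move=> HF HG.
(* The conjunct [0 < G] makes the count vanish for a zero divisor, in agreement with [divn0]. *)
have H : decidable_on a.+1 (fun w =>
    (0 < G (behead w)) && ((nth 0 w 0).+1 * G (behead w) <= F (behead w))).
  have HG' := calculable_behead HG.
  apply: decidable_and; first exact: decidable_leq (calculable_const _ 1) HG'.
  apply: decidable_leq; last exact: calculable_behead.
  exact: calculable_mul (calculable_succ (calculable_nth _ _)) HG'.
have := calculable_sum (f := fun i v => (0 < G v) && (i.+1 * G v <= F v) : nat) H HF.
apply: eq_calculable => v _; have [G0|G0] := posnP (G v).
  by rewrite G0 divn0 big1.
under eq_bigr => i _ do rewrite -leq_divRL //=.
exact/sum_ltn/leq_div.
Qed.

Lemma calculable_mod a F G :
  calculable a F -> calculable a G -> calculable a (fun v => F v %% G v).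
Proof.
move=> HF HG; have := calculable_sub HF (calculable_mul (calculable_div HF HG) HG).
by apply: eq_calculable => v _; rewrite {1}(divn_eq (F v) (G v)) addKn.
Qed.

Lemma calculable_find a (P : nat -> seq nat -> bool) n :
  decidable_on a.+1 (fun w => P (nth 0 w 0) (behead w)) -> calculable a n ->
  calculable a (fun v => find (P ^~ v) (iota 0 (n v))).
Proof.
move=> HP Hn.
(* An index lies before the first hit if and only if no [j] up to it is a hit; without any hit the
   count is [n v], the default of [find]. *)
have Ha : calculable a.+1 (fun w => nat_of_bool
    [forall j : 'I_(nth 0 w 0).+1, ~~ P j (behead w)]).
  apply: (@decidable_forall a.+1 (fun j w => ~~ P j (behead w))).
    exact/decidable_neg/(calculable_skip1 (f := fun i v => P i v : nat) HP).
  exact: calculable_succ (calculable_nth _ _).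
have := calculable_sum (f := fun i v => [forall j : 'I_i.+1, ~~ P j v] : nat) Ha Hn.
apply: eq_calculable => v _; set k := find _ _.
have Hk : k <= n v by rewrite -[leqRHS](size_iota 0) find_size.
rewrite -[RHS](sum_ltn Hk); apply: eq_bigr => i _; congr nat_of_bool.
apply/forallP/idP => [H|ik j].
  rewrite ltnNge; apply/negP => ki.
  have := H (Ordinal (ki : k < i.+1)); rewrite /=.
  have Hs : has (P ^~ v) (iota 0 (n v)).
    by rewrite has_find size_iota; apply: leq_ltn_trans ki (ltn_ord i).
  have := nth_find 0 Hs; rewrite -/k nth_iota ?add0n; last first.
    exact: leq_ltn_trans ki (ltn_ord i).
  by move->.
have jk : j < k by apply: leq_ltn_trans ik; rewrite -ltnS.
have := before_find 0 jk; rewrite nth_iota ?add0n; first by move->.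
exact: leq_trans jk Hk.
Qed.

(** * Approximating partial recursive functions in stages *)

Lemma mu_code_nested_ind (P : mu_code -> Prop) :
  P Zero -> P Succ -> (forall i, P (Proj i)) ->
  (forall f gs, P f -> foldr (fun g => and (P g)) True gs -> P (Comp f gs)) ->
  (forall f g, P f -> P g -> P (Prec f g)) -> (forall f, P f -> P (Mu f)) ->
  forall c, P c.
Proof.
move=> H0 HS HP HC HR HM; fix IH 1; case => [||i|f gs|f g|f].
- exact: H0.
- exact: HS.
- exact: HP.
- apply: HC; first exact: IH.
  by elim: gs => [|g gs IHs]; [exact: I | exact: conj (IH g) IHs].
- exact: HR.
- exact: HM.
Qed.

(* The value [B (t :: v)] is [y.+1] if the computation on [v] is seen by stage
   [t] to converge to [y], and [0] as long as it is not seen to converge. *)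
Definition stage_simulation (a : nat) (c : mu_code) (B : seq nat -> nat) : Prop :=
  [/\ calculable a.+1 B,
      forall v y, size v = a -> mu_eval c v y <-> exists t, B (t :: v) = y.+1
    & forall v y t t', size v = a -> t <= t' ->
        B (t :: v) = y.+1 -> B (t' :: v) = y.+1].

Lemma simulation_total a c F :
  calculable a F -> (forall v y, size v = a -> mu_eval c v y <-> y = F v) ->
  exists B, stage_simulation a c B.
Proof.
move=> HF Hc; exists (fun w => (F (behead w)).+1); split => //.
- exact/calculable_succ/calculable_behead.
- by move=> v y sv; rewrite Hc //=; split=> [->|[_ [->]]] //; exists 0.
Qed.

Lemma simulation_Comp a f gs :
  (forall b, exists B, stage_simulation b f B) ->
  foldr (fun g => and (forall b, exists B, stage_simulation b g B)) True gs ->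
  exists B, stage_simulation a (Comp f gs) B.
Proof.
move=> /(_ (size gs)) [Bf [cf ef mf]] Hgs.
suff [Bs [sBs cBs eBs mBs]] : exists Bs : seq (seq nat -> nat), [/\ size Bs = size gs,
    forall i, i < size Bs -> calculable a.+1 (nth (fun=> 0) Bs i),
    forall v ws, size v = a -> mu_evals gs v ws <->
      exists t, [seq B (t :: v) | B <- Bs] = [seq w.+1 | w <- ws]
  & forall v t t' ws, size v = a -> t <= t' ->
      [seq B (t :: v) | B <- Bs] = [seq w.+1 | w <- ws] ->
      [seq B (t' :: v) | B <- Bs] = [seq w.+1 | w <- ws]].
  (* [vals] reads an inner computation that has not converged as [0]; the factor [conv] blocks the
     result until all of them have converged. *)
  pose conv w := all (fun B => 0 < B w) Bs.
  pose vals w := [seq (B w).-1 | B <- Bs].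
  have spec v t y : conv (t :: v) * Bf (t :: vals (t :: v)) = y.+1 <->
      exists ws, [/\ size ws = size gs,
        [seq B (t :: v) | B <- Bs] = [seq w.+1 | w <- ws] & Bf (t :: ws) = y.+1].
    split.
      case: (boolP (conv _)) => [Hconv|//]; rewrite mul1n => HB.
      exists (vals (t :: v)); split=> //; first by rewrite size_map sBs.
      move: Hconv; rewrite /conv /vals; elim: (Bs) => [//|B Bs' IH] /= /andP[B0 /IH ->].
      by rewrite prednK.
    move=> [ws [sws E HB]].
    have -> : conv (t :: v).
      have : all (fun n => 0 < n) [seq B (t :: v) | B <- Bs].
        by rewrite E all_map; apply/allP.
      by rewrite all_map.
    have -> : vals (t :: v) = ws.
      by rewrite /vals (map_comp predn (fun B => B (t :: v))) E -map_comp map_id.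
    by rewrite mul1n.
  exists (fun w => conv w * Bf (head 0 w :: vals w)); split.
  - apply: calculable_mul.
      rewrite /conv; elim: (Bs) cBs => [|B Bs' IH] cBs.
        exact: (calculable_const _ 1).
      apply: decidable_and; last by apply: IH => i Hi; apply: (cBs i.+1).
      by apply: decidable_leq; [exact: calculable_const | apply: (cBs 0)].
    have c_args := calculable_comp (G := fun i w => nth 0 (head 0 w :: vals w) i) cf.
    apply: eq_calculable (c_args _ _) => [w sw|[|i] Hi /=].
    - by congr Bf; apply: nth_eq_mkseq => //=; rewrite size_map sBs.
    - by apply: eq_calculable (calculable_nth _ 0) => -[|].
    - have iB : i < size Bs by rewrite sBs.
      apply: eq_calculable (calculable_pred (cBs i iB)) => v _.
      by rewrite (nth_map (fun=> 0)).
  - move=> v y sv; rewrite mu_eval_Comp; split.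
      move=> [ws /(eBs _ _ sv) [t Ht]].
      have sws : size ws = size gs.
        by move/(congr1 size): Ht; rewrite !size_map sBs.
      move=> /(ef _ _ sws) [t' Ht']; exists (maxn t t').
      apply/spec; exists ws; split => //.
        by apply: mBs Ht => //; rewrite leq_maxl.
      by apply: mf Ht' => //; rewrite leq_maxr.
    move=> [t /spec [ws [sws Ht Ht']]]; exists ws.
      by apply/eBs => //; exists t.
    by apply/ef => //; exists t.
  - move=> v y t t' sv tt' /spec [ws [sws Ht Ht']].
    apply/spec; exists ws; split => //; first exact: mBs Ht.
    exact: mf Ht'.
elim: gs Hgs {Bf cf ef mf} => [_|g gs IH /= [/(_ a) [B [cB eB mB]] /IH [Bs [sBs cBs eBs mBs]]]].
  exists [::]; split=> //= v [|w ws] sv /=; first by split=> // _; exists 0.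
  by split=> // -[].
exists (B :: Bs); split => /=.
- by rewrite sBs.
- by case=> [//|i]; apply: cBs.
- move=> v [|w ws] sv /=; first by split=> // -[].
  rewrite eB // eBs //; split=> [[[t Ht] [t' Ht']]|[t [Ht Ht']]].
    exists (maxn t t'); congr cons.
      by apply: mB Ht => //; rewrite leq_maxl.
    by apply: mBs Ht' => //; rewrite leq_maxr.
  by split; exists t.
- move=> v t t' [|w ws] sv tt' //= [Ht Ht']; congr cons; first exact: mB Ht.
  exact: mBs Ht'.
Qed.

Lemma simulation_Prec a f g :
  (forall b, exists B, stage_simulation b f B) ->
  (forall b, exists B, stage_simulation b g B) ->
  exists B, stage_simulation a (Prec f g) B.
Proof.
move=> /(_ a.-1) [Bf [cf ef mf]] /(_ a.-1.+2) [Bg [cg eg mg]].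
(* The factor [0 < z] keeps nonconvergence at one step from being taken for the value [0] at the
   next. *)
pose G i z t v := (0 < z) * Bg [:: t, i, z.-1 & v].
pose B t v n := nat_rect (fun=> nat) (Bf (t :: v)) (fun i z => G i z t v) n.
have BS t v n y : B t v n.+1 = y.+1 <->
    exists2 z, B t v n = z.+1 & Bg [:: t, n, z & v] = y.+1.
  rewrite /B /= /G -/(B t v n); case: (B t v n) => [|z]; last rewrite mul1n.
    by split=> // -[].
  by split=> [|[_ [<-]]] // E; exists z.
have mB v n y t t' : size v = a.-1 -> t <= t' -> B t v n = y.+1 -> B t' v n = y.+1.
  move=> sv tt'; elim: n y => [|n IH] y; first exact: mf.
  by move=> /BS[z /IH Hz Hy]; apply/BS; exists z => //; apply: mg Hy => //; rewrite /= sv.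
have eB v n y : size v = a.-1 -> prec_graph f g v n y <-> exists t, B t v n = y.+1.
  move=> sv; elim: n y => [|n IH] y /=; first exact: ef.
  have svv z : size [:: n, z & v] = a.-1.+2 by rewrite /= sv.
  split=> [[z /IH [t Ht] /(eg _ _ (svv z)) [t' Ht']]|[t /BS [z Hz Hy]]].
    exists (maxn t t'); apply/BS; exists z; first exact: mB (leq_maxl _ _) Ht.
    exact: mg (svv z) (leq_maxr _ _) Ht'.
  exists z; first by apply/IH; exists t.
  by apply/eg => //; exists t.
exists (fun w => B (nth 0 w 0) (behead (behead w)) (nth 0 w 1)); split.
- have Hf : calculable a.+1 (fun w => Bf (nth 0 w 0 :: behead (behead w))).
    have := calculable_rename a.+1 (fun i => if i is j.+1 then j.+2 else 0) cf.
    apply: eq_calculable => w sw.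
    congr (Bf _); apply: nth_eq_mkseq; first by rewrite /= !size_behead sw.
    by case=> [|i] _ //=; rewrite !nth_behead.
  have Hg : calculable a.+3 (fun w =>
      Bg [:: nth 0 (behead (behead w)) 0, nth 0 w 0, (nth 0 w 1).-1
        & behead (behead (behead (behead w)))]).
    have HH := calculable_comp (a := a.+3) (G := fun i w => nth 0 [:: nth 0 w 2,
      nth 0 w 0, (nth 0 w 1).-1 & behead (behead (behead (behead w)))] i) cg.
    apply: eq_calculable (HH _).
      move=> w sw; rewrite !nth_behead; congr (Bg _).
      by apply: nth_eq_mkseq; rewrite //= !size_behead sw.
    case=> [|[|[|i]]] _; [exact: calculable_nth| exact: calculable_nth
      | exact: calculable_pred (calculable_nth _ _)|].
    by apply: eq_calculable (calculable_nth _ i.+4) => w _; rewrite /= !nth_behead.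
  have := @calculable_rec a.+1 (fun w => Bf (nth 0 w 0 :: behead (behead w)))
    (fun i z w => G i z (nth 0 w 0) (behead (behead w))) (fun w => nth 0 w 1) Hf.
  apply; last exact: calculable_nth.
  apply: calculable_mul => //.
  exact: decidable_leq (calculable_const _ 1) (calculable_nth _ 1).
- move=> v y sv; rewrite mu_eval_Prec eB /=; last by rewrite size_behead sv.
  by rewrite /=; case: v sv.
- move=> v y t t' sv tt' /=.
  by case: v sv => [|n v] sv; apply: mB => //; rewrite -sv.
Qed.

Lemma simulation_Mu a f :
  (forall b, exists B, stage_simulation b f B) ->
  exists B, stage_simulation a (Mu f) B.
Proof.
move=> /(_ a.+1) [Bf [cf ef mf]].
(* [Bf <= 1] means that stage [t] sees no value yet ([0]) or the value [0] ([1]). The search stops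
   at the first such [y], and [B] accepts it only in the second case. *)
pose y0 t v := find (fun y => Bf [:: t, y & v] <= 1) (iota 0 t).
pose B t v := (Bf [:: t, y0 t v & v] == 1) * (y0 t v).+1.
have BP t v y : B t v = y.+1 <->
    [/\ y <= t, Bf [:: t, y & v] = 1 & forall i, i < y -> 1 < Bf [:: t, i & v]].
  have y0t : y0 t v <= t.
    by apply: leq_trans (find_size _ _) _; rewrite size_iota.
  have lt_y0 i : i < y0 t v -> 1 < Bf [:: t, i & v].
    move=> Hi; have := before_find 0 Hi; rewrite nth_iota ?add0n.
      by move/negbT; rewrite -ltnNge.
    exact: leq_trans Hi y0t.
  rewrite /B; split.
    by case: eqP => // Hy; rewrite mul1n => -[<-].
  move=> [yt Hy1 Hy]; suff -> : y0 t v = y by rewrite Hy1 mul1n.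
  apply/eqP; rewrite eqn_leq; apply/andP; split; rewrite leqNgt; apply/negP.
    by move/lt_y0; rewrite Hy1.
  move=> Hlt; have := Hy _ Hlt; rewrite ltnNge => /negP; apply.
  have Hs : has (fun y => Bf [:: t, y & v] <= 1) (iota 0 t).
    by rewrite has_find size_iota; apply: leq_trans Hlt yt.
  have := nth_find 0 Hs; rewrite nth_iota // -/(y0 t v).
  exact: leq_trans Hlt yt.
have eB v y : size v = a -> mu_eval (Mu f) v y <-> exists t, B t v = y.+1.
  move=> sv; have svv i : size (i :: v) = a.+1 by rewrite /= sv.
  split=> [[/(ef _ _ (svv y)) [t0 Ht0] Hlt]|[t /BP [yt Hy1 Hlt]]]; last first.
    split; first by apply/ef => //; exists t.
    move=> i /Hlt; case E : (Bf _) => [|[|z]] // _; exists z.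
    by apply/ef => //; exists t.
  suff [t1 Ht1] : exists t1, forall i, i < y -> 1 < Bf [:: t1, i & v].
    exists (maxn y (maxn t0 t1)); apply/BP; split.
    - by rewrite leq_maxl.
    - by apply: mf Ht0 => //; rewrite !leq_max leqnn orbT.
    - move=> i /Ht1; case E : (Bf _) => [|[|z]] // _.
      by rewrite (mf _ _ _ _ (svv i) _ E) // !leq_max leqnn !orbT.
  elim: y Hlt {Ht0} => [|y IH] Hlt; first by exists 0.
  have [t1 Ht1] := IH (fun i Hi => Hlt i (ltnW Hi)).
  have [z /(ef _ _ (svv y)) [t2 Ht2]] := Hlt y (ltnSn y).
  exists (maxn t1 t2) => i; rewrite ltnS leq_eqVlt => /predU1P[->|/Ht1].
    by rewrite (mf _ _ _ _ (svv y) _ Ht2) ?leq_maxr.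
  case E : (Bf _) => [|[|z']] // _.
  by rewrite (mf _ _ _ _ (svv i) _ E) ?leq_maxl.
exists (fun w => B (nth 0 w 0) (behead w)); split => //.
  have Hf : calculable a.+2 (fun w => Bf [:: nth 0 w 1, nth 0 w 0 & behead (behead w)]).
    have := calculable_rename a.+2 (fun i => if i is 0 then 1 else if i is 1 then 0 else i) cf.
    apply: eq_calculable => -[|y [|t v]] // [sv]; congr (Bf _).
    rewrite /mkseq /= -[2]addn0 iotaDl -map_comp; congr [:: _, _ & _].
    exact: (nth_eq_mkseq sv).
  have Hy0 : calculable a.+1 (fun w => y0 (nth 0 w 0) (behead w)).
    apply: (@calculable_find a.+1 (fun y w => Bf [:: nth 0 w 0, y & behead w] <= 1)).
      apply: decidable_leq; last exact: calculable_const.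
      by apply: eq_calculable Hf => w _; rewrite nth_behead.
    exact: calculable_nth.
  apply: calculable_mul; last exact: calculable_succ.
  apply: decidable_eq; last exact: calculable_const.
  have := calculable_comp (a := a.+1) (G := fun i w => if i is 0 then nth 0 w 0
    else if i is 1 then y0 (nth 0 w 0) (behead w) else nth 0 w i.-1) cf.
  move=> HH; apply: eq_calculable (HH _).
    move=> [|t v] // [sv]; congr (Bf _).
    rewrite /mkseq /= -[2]addn0 iotaDl -map_comp; congr [:: _, _ & _].
    exact: (nth_eq_mkseq sv).
  by case=> [|[|i]] _ //; exact: calculable_nth.
move=> v y t t' sv tt' /BP [yt Hy1 Hlt]; apply/BP.
have svv i : size (i :: v) = a.+1 by rewrite /= sv.
split; [exact: leq_trans yt tt'|exact: mf (svv y) tt' Hy1|].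
move=> i /Hlt; case E : (Bf _) => [|[|z']] // _.
by rewrite (mf _ _ _ _ (svv i) tt' E).
Qed.

Lemma simulation_exists a c : exists B, stage_simulation a c B.
Proof.
elim/mu_code_nested_ind: c a => [||i|f gs IHf IHgs|f g IHf IHg|f IHf] a.
- exact: (simulation_total (calculable_const _ 0)).
- exact: (simulation_total (calculable_succ (calculable_nth _ 0))).
- exact: (simulation_total (calculable_nth _ i)).
- exact: simulation_Comp.
- exact: simulation_Prec.
- exact: simulation_Mu.
Qed.

(** By monotonicity both values appear at a common stage of the simulation, which can show only
    one. *)
Lemma mu_eval_functional c v y y' : mu_eval c v y -> mu_eval c v y' -> y = y'.
Proof.
have [B [_ eB mB]] := simulation_exists (size v) c.
move=> /(eB _ _ erefl) [t Ht] /(eB _ _ erefl) [t' Ht'].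
apply: succn_inj.
rewrite -(mB _ _ _ _ erefl (leq_maxl t t') Ht).
exact: mB _ _ _ _ erefl (leq_maxr t t') Ht'.
Qed.

(** Turns a decidable relation into a machine that diverges on inputs without a solution; the
    compressing machine arises in this way. *)
Lemma mu_search (P : nat -> nat -> bool) :
  decidable_on 2 (fun w => P (nth 0 w 0) (nth 0 w 1)) ->
  exists c, forall x y, mu_eval c [:: x] y <-> P y x /\ forall i, i < y -> ~~ P i x.
Proof.
move=> /decidable_neg [c Hc]; exists (Mu c) => x y /=.
split=> [[Hy Hlt]|[Py Hlt]]; last first.
  split; first by have := Hc [:: y; x] erefl; rewrite /= Py.
  by move=> i /Hlt Pi; exists 0; have := Hc [:: i; x] erefl; rewrite /= Pi.
split.
  by have := mu_eval_functional Hy (Hc [:: y; x] erefl); rewrite /=; case: (P y x).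
move=> i /Hlt [z Hz].
by have := mu_eval_functional Hz (Hc [:: i; x] erefl); rewrite /=; case: (P i x).
Qed.

Lemma calculable_least a (P : nat -> seq nat -> bool) (F : seq nat -> nat) :
  decidable_on a.+1 (fun w => P (nth 0 w 0) (behead w)) ->
  (forall v, P (F v) v) -> (forall v i, i < F v -> ~~ P i v) -> calculable a F.
Proof.
move=> /decidable_neg [c Hc] PF ltF; exists (Mu c) => v sv /=; split.
  by have := Hc (F v :: v); rewrite /= sv PF; apply.
by move=> i /ltF Pi; exists 0; have := Hc (i :: v); rewrite /= sv Pi; apply.
Qed.

(** * Binary strings and their numbers *)

Lemma strn_cat s t : strn (s ++ t) = strn s + 2 ^ size s * strn t.
Proof.
elim: s => [|b s IH] /=; first by rewrite add0n mul1n.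
rewrite /strn /= -!/(strn _) IH expnS; lia.
Qed.

Lemma strn_bounds s : 2 ^ size s <= (strn s).+1 < 2 ^ (size s).+1.
Proof.
elim: s => [//|b s /andP[IH1 IH2]]; rewrite /strn /= -/(strn s).
rewrite expnS in IH1 *; rewrite [2 ^ _.+2]expnS; case: b => /=; lia.
Qed.

Lemma strn_inj : injective strn.
Proof.
elim=> [|b s IH] [|b' s']; rewrite /strn //= -?/(strn _); try by case: b || case: b'; lia.
move=> E; have Eb : b = b' by move: E; case: b; case: b' => //=; lia.
by rewrite -Eb in E *; congr cons; apply: IH; lia.
Qed.

Lemma strn_surj n : exists s, strn s = n.
Proof.
elim/ltn_ind: n => -[|n] IH; first by exists [::].
have [s Hs] := IH n./2 ltac:(lia).
by exists (odd n :: s); rewrite /strn /= -/(strn s) Hs; case: odd (odd_double_half n) => /=; lia.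
Qed.

Definition str (n : nat) : seq bool := sval (cid (strn_surj n)).

Lemma strK : cancel str strn.
Proof. by move=> n; rewrite /str; case: cid. Qed.

Lemma strnK : cancel strn str.
Proof. by move=> s; apply: strn_inj; rewrite strK. Qed.

(** The strings of length [n] have the numbers from [2 ^ n - 1] to [2 ^ n.+1 - 2]. The bits of [r]
    are listed from the least significant one, so taking a prefix of length [j] is reduction modulo
    [2 ^ j]. *)
Definition bstr (n r : nat) : seq bool := str (2 ^ n - 1 + r).

Definition bnum (s : seq bool) : nat := strn s - (2 ^ size s - 1).

Lemma strn_bstr n r : (strn (bstr n r)).+1 = 2 ^ n + r.
Proof. by rewrite strK; have := expn_gt0 2 n; lia. Qed.

Lemma size_bstr n r : r < 2 ^ n -> size (bstr n r) = n.
Proof.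
move=> rn; have /andP[H1 H2] := strn_bounds (bstr n r).
rewrite !strn_bstr in H1 H2; set m := size _ in H1 H2 *.
have mn : m < n.+1 by rewrite -(@ltn_exp2l 2) // expnS; lia.
have nm : n < m.+1 by rewrite -(@ltn_exp2l 2) //; lia.
lia.
Qed.

Lemma bnum_lt s : bnum s < 2 ^ size s.
Proof.
have /andP[] := strn_bounds s; rewrite /bnum expnS; lia.
Qed.

Lemma bnumK s : bstr (size s) (bnum s) = s.
Proof.
apply: strn_inj; apply: succn_inj; rewrite strn_bstr /bnum.
have /andP[] := strn_bounds s; have := expn_gt0 2 (size s); lia.
Qed.

Lemma bstrK n r : r < 2 ^ n -> bnum (bstr n r) = r.
Proof.
move=> rn; rewrite /bnum size_bstr //; have := strn_bstr n r.
have := expn_gt0 2 n; lia.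
Qed.

Lemma bstr_cat n m r q : r < 2 ^ n -> bstr n r ++ bstr m q = bstr (n + m) (r + 2 ^ n * q).
Proof.
move=> rn; apply: strn_inj; apply: succn_inj; rewrite strn_bstr strn_cat size_bstr //.
rewrite -addSn strn_bstr expnD; have Hm := strn_bstr m q.
have -> : 2 ^ n * 2 ^ m + (r + 2 ^ n * q) = r + 2 ^ n * (2 ^ m + q) by lia.
rewrite -Hm; lia.
Qed.

Lemma take_bstr j n r : j <= n -> r < 2 ^ n -> take j (bstr n r) = bstr j (r %% 2 ^ j).
Proof.
move=> jn rn; have rj : r %% 2 ^ j < 2 ^ j by rewrite ltn_mod expn_gt0.
have E : bstr j (r %% 2 ^ j) ++ bstr (n - j) (r %/ 2 ^ j) = bstr n r.
  by rewrite bstr_cat // subnKC // mulnC addnC -divn_eq.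
by rewrite -E take_size_cat // size_bstr.
Qed.

Lemma sum_ord_mul m n (F : nat -> nat) :
  \sum_(i < m * n) F i = \sum_(j < m) \sum_(i < n) F (j * n + i).
Proof.
elim: m => [|m IH]; first by rewrite mul0n !big_ord0.
rewrite big_ord_recr /= -IH mulSn addnC -(big_mkord predT F).
rewrite (@big_cat_nat _ _ _ (m * n)) ?leq_addr //= big_mkord; congr (_ + _).
rewrite -{1}[m * n]add0n big_addn addKn big_mkord.
by apply: eq_bigr => i _; rewrite addnC.
Qed.

(** * Compression of effectively null sets *)

Section Compression.
Variables (A : nat -> nat -> bool) (s : nat -> nat).
Hypothesis decA : decidable_on 2 (fun w => A (nth 0 w 0) (nth 0 w 1)).
Hypothesis compS : calculable 1 (fun w => s (nth 0 w 0)).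
Hypothesis smallA : forall k, (\sum_(r < 2 ^ s k) A k r) * 2 ^ (2 * k) <= 2 ^ s k.

Let rank k r := \sum_(i < r) A k i.

Let lt_rank k r r' : A k r -> r < r' -> rank k r < rank k r'.
Proof.
move=> Ar rr'; rewrite -[rank k r']/(\sum_(i < r') A k i) -(big_mkord predT (fun i => A k i : nat)).
rewrite (@big_cat_nat _ _ _ r.+1) //= big_nat_recr //= Ar addn1.
by rewrite /rank big_mkord addSn ltnS leq_addr.
Qed.

Let rank_inj k r r' : A k r -> A k r' -> rank k r = rank k r' -> r = r'.
Proof.
move=> Ar Ar' E; case: (ltngtP r r') => // H.
- by have := lt_rank Ar H; rewrite E ltnn.
- by have := lt_rank Ar' H; rewrite E ltnn.
Qed.

Let rank_lt k r : A k r -> r < 2 ^ s k -> 2 * k <= s k /\ rank k r < 2 ^ (s k - 2 * k).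
Proof.
move=> Ar rs; have Hlt : rank k r < \sum_(r < 2 ^ s k) A k r by apply: lt_rank Ar rs.
have Hpos := expn_gt0 2 (2 * k).
(* As [r] belongs to [A k], the count in [smallA] is at least one. *)
have ks : 2 * k <= s k.
  rewrite -(leq_exp2l (m := 2)) //; apply: leq_trans (smallA k).
  rewrite leq_pmull //; exact: leq_ltn_trans Hlt.
split=> //; apply: leq_trans Hlt _; rewrite -(leq_pmul2r Hpos).
by rewrite -expnD subnK.
Qed.

(* [0^k 1 y], where [y] has length [s k - 2 * k] and is the index of [r] among
   the elements of [A k]. *)
Let prog k r := nseq k false ++ true :: bstr (s k - 2 * k) (rank k r).

Let strn_prog k r :
  (strn (prog k r)).+1 = 2 ^ k * (2 * (2 ^ (s k - 2 * k) + rank k r)).+1.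
Proof.
rewrite strn_cat size_nseq.
have : (strn (nseq k false)).+1 = 2 ^ k.
  by elim: k => [//|k IH]; rewrite /strn /= -/(strn _) expnS -IH; lia.
have := strn_bstr (s k - 2 * k) (rank k r).
rewrite {2}/strn /= -/(strn _) => H1 H2; rewrite -addSn H2 -mulnS -H1.
by congr (_ * _); lia.
Qed.

(** Here [z] is the number of the output and [N] that of the program. As [2 ^ k] divides [N.+1], the
    search for [k] is bounded, and [r] is read off from [z]. *)
Let test z N := [exists k : 'I_N.+1,
  [&& 2 ^ s k <= z.+1, z.+1 - 2 ^ s k < 2 ^ s k, A k (z.+1 - 2 ^ s k)
    & N.+1 == 2 ^ k * (2 * (2 ^ (s k - 2 * k) + rank k (z.+1 - 2 ^ s k))).+1]].

Let testP t p : reflect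
  (exists k r, [/\ A k r, r < 2 ^ s k, t = bstr (s k) r & p = prog k r])
  (test (strn t) (strn p)).
Proof.
apply: (iffP existsP) => [[k /and4P[H1 H2 H3 /eqP H4]]|[k [r [Ar rs -> ->]]]].
  exists k, ((strn t).+1 - 2 ^ s k); split => //.
    by apply: strn_inj; apply: succn_inj; rewrite strn_bstr subnKC.
  by apply: strn_inj; apply: succn_inj; rewrite strn_prog.
have kp : k < (strn (prog k r)).+1.
  rewrite strn_prog; apply: leq_trans (ltn_expl k (isT : 1 < 2)) _.
  by rewrite leq_pmulr.
exists (Ordinal kp) => /=.
by rewrite strn_bstr strn_prog addKn leq_addr rs Ar eqxx.
Qed.

Let test_decidable : decidable_on 2 (fun w => test (nth 0 w 0) (nth 0 w 1)).
Proof.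
pose sk (w : seq nat) := s (nth 0 w 0).
have c_sk : calculable 3 sk by apply: calculable_comp1 compS (calculable_nth _ _).
have c_psk : calculable 3 (fun w => 2 ^ sk w).
  exact: calculable_exp (calculable_const _ _) c_sk.
have c_z : calculable 3 (fun w => (nth 0 (behead w) 0).+1).
  exact/calculable_succ/(calculable_behead (calculable_nth 2 0)).
have c_N : calculable 3 (fun w => (nth 0 (behead w) 1).+1).
  exact/calculable_succ/(calculable_behead (calculable_nth 2 1)).
have c_r := calculable_sub c_z c_psk.
have c_rank : calculable 3
    (fun w => rank (nth 0 w 0) ((nth 0 (behead w) 0).+1 - 2 ^ sk w)).
  have H : calculable 2 (fun w => rank (nth 0 w 0) (nth 0 w 1)).
    apply: (@calculable_sum 2 (fun i w => A (nth 0 w 0) i)); last exact: calculable_nth.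
    apply: (calculable_comp2 (f := fun k i => A k i : nat) decA); last exact: calculable_nth.
    exact/(calculable_behead (calculable_nth 2 0)).
  exact: (calculable_comp2 (f := rank) H (calculable_nth _ _) c_r).
apply: (@decidable_exists 2 (fun k w => [&& 2 ^ s k <= (nth 0 w 0).+1,
   (nth 0 w 0).+1 - 2 ^ s k < 2 ^ s k, A k ((nth 0 w 0).+1 - 2 ^ s k)
  & (nth 0 w 1).+1 == 2 ^ k * (2 * (2 ^ (s k - 2 * k) + rank k ((nth 0 w 0).+1 - 2 ^ s k))).+1])).
  apply: decidable_and; first exact: decidable_leq c_psk c_z.
  apply: decidable_and; first exact: decidable_leq (calculable_succ c_r) c_psk.
  apply: decidable_and.
    exact: (calculable_comp2 (f := fun k r => A k r : nat) decA (calculable_nth _ _) c_r).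
  apply: (decidable_eq c_N); apply: calculable_mul.
    exact: calculable_exp (calculable_const _ _) (calculable_nth _ _).
  apply/calculable_succ/(calculable_mul (calculable_const _ _)).
  apply: calculable_add c_rank; apply: calculable_exp (calculable_const _ _) _.
  apply: calculable_sub c_sk _.
  exact: calculable_mul (calculable_const _ _) (calculable_nth _ _).
exact/calculable_succ/calculable_nth.
Qed.

Let index_prog k r t : index true (prog k r ++ t) = k.
Proof.
rewrite /prog -catA index_cat mem_nseq andbF size_nseq /=; lia.
Qed.

(** The programs are self-delimiting: the first [true] reveals [k], hence the total length, and the
    remaining bits are the rank, which determines [r]. *)
Let prog_inj k r k' r' : A k r -> r < 2 ^ s k -> A k' r' -> r' < 2 ^ s k' ->
  prefix (prog k r) (prog k' r') -> k = k' /\ r = r'.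
Proof.
move=> Ar rs Ar' rs' /prefixP [t E].
have Ek : k = k'.
  by rewrite -(index_prog k' r' [::]) cats0 E index_prog.
move: Ar' rs' E; rewrite -{}Ek => Ar' rs' E; split=> //.
have [_ Hr] := rank_lt Ar rs; have [_ Hr'] := rank_lt Ar' rs'.
apply: (rank_inj Ar Ar').
have /eqP := E; rewrite /prog -catA eqseq_cat // eqxx /= => /eqP [E'].
rewrite -(bstrK Hr) -(bstrK Hr'); congr bnum.
have : size t = 0.
  by have /(congr1 size) := E'; rewrite size_cat !size_bstr //; lia.
by move/size0nil=> t0; rewrite E' t0 cats0.
Qed.

(** A program has [k + 1 + (s k - 2 * k)] bits, a saving of [k - 1]; the missing bit is absorbed by
    taking [d.+1]. *)
Lemma effectively_null_compressible U : optimal_prefix_free U ->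
  exists d, forall k r, A k r -> r < 2 ^ s k ->
    exists2 q, runs U q (bstr (s k) r) & size q + k <= s k + d.
Proof.
move=> [_ optU]; have [M HM] := mu_search test_decidable.
have runsM p t : runs M p t ->
    exists k r, [/\ A k r, r < 2 ^ s k, t = bstr (s k) r & p = prog k r].
  by rewrite /runs HM => -[/testP].
have pfM : prefix_free M.
  move=> p q t t' /runsM [k [r [Ar rs _ ->]]] /runsM [k' [r' [Ar' rs' _ ->]]].
  by case/prog_inj=> // -> ->.
have [d Hd] := optU M pfM; exists d.+1 => k r Ar rs.
have Hrun : runs M (prog k r) (bstr (s k) r).
  rewrite /runs HM; split; first by apply/testP; exists k, r.
  move=> i; apply: contraL => /=; rewrite -[i]strK => /testP.
  move=> [k' [r' [Ar' rs' -> /eqP Ep]]].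
  have [|<- <-] := prog_inj Ar rs Ar' rs'; first by rewrite (eqP Ep) prefix_refl.
  by rewrite ltnn.
have [q Uq qd] := Hd _ _ Hrun; exists q => //.
have [ks Hr] := rank_lt Ar rs.
by move: qd; rewrite /prog size_cat size_nseq /= size_bstr //; lia.
Qed.

End Compression.

(** * Incompressible paths *)

Lemma size_cprefix x n : size (cprefix x n) = n.
Proof. exact: size_mkseq. Qed.

Lemma take_cprefix x m n : m <= n -> take m (cprefix x n) = cprefix x m.
Proof. by move=> mn; rewrite /cprefix /mkseq -map_take take_iota (minn_idPl mn). Qed.

Lemma path_exists (Q : seq bool -> Prop) s :
  (forall t, Q t -> exists b, Q (rcons t b)) -> Q s ->
  exists x, cprefix x (size s) = s /\ forall n, size s <= n -> Q (cprefix x n).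
Proof.
move=> step Qs; pose next t := rcons t `[< Q (rcons t true) >].
pose u n := iter n next s.
have su n : size (u n) = size s + n.
  by elim: n => [|n IH]; rewrite ?addn0 //= size_rcons IH addnS.
have Qu n : Q (u n).
  elim: n => [//|n IH] /=; rewrite /next; case: asboolP => // nQ.
  by have [[]] := step _ IH.
pose x : cantor_space := fun i => nth false (u i.+1) i.
have nth_u n m i : i < size s + n -> nth false (u (n + m)) i = nth false (u n) i.
  move=> Hi; elim: m => [|m IH]; first by rewrite addn0.
  by rewrite addnS /= nth_rcons su -IH ifT //; lia.
have ux n : cprefix x (size s + n) = u n.
  apply: (@eq_from_nth _ false); rewrite size_cprefix ?su // => i Hi.
  rewrite nth_mkseq // /x -(nth_u n i.+1 i Hi) [n + _]addnC.
  by rewrite (nth_u i.+1 n i) //; lia.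
exists x; split; first by have := ux 0; rewrite addn0.
by move=> n sn; rewrite -(subnKC sn) ux.
Qed.

Lemma eventually_all N (P : nat -> nat -> Prop) :
  (forall i t t', t <= t' -> P t i -> P t' i) ->
  (forall i, i < N -> exists t, P t i) -> exists t, forall i, i < N -> P t i.
Proof.
move=> mono; elim: N => [|N IH] ex; first by exists 0.
have [t Ht] := IH (fun i Hi => ex i (ltnW Hi)).
have [t' Ht'] := ex N (ltnSn N).
exists (maxn t t') => i; rewrite ltnS leq_eqVlt => /predU1P[->|/Ht].
  exact: mono (leq_maxr _ _) Ht'.
exact/mono/leq_maxl.
Qed.

Definition avoids (D : seq bool -> Prop) (s : seq bool) : Prop :=
  forall i, ~ D (take i s).

Lemma avoids_cprefix D x :
  (forall n, avoids D (cprefix x n)) <-> (forall n, ~ D (cprefix x n)).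
Proof.
split=> [H n|H n i]; first by have := H n n; rewrite -{1}(size_cprefix x n) take_size.
have [iN|/ltnW ni] := leqP i n; first by rewrite take_cprefix.
by rewrite take_oversize ?size_cprefix.
Qed.

Lemma avoids_catl D s t : avoids D (s ++ t) -> avoids D s.
Proof.
move=> H i; have [iN|/ltnW ni] := leqP i (size s).
  by have := H i; rewrite takel_cat.
by have := H (size s); rewrite take_size_cat // take_oversize.
Qed.

(** König's lemma. If both children of [t] failed, at depths [m1] and [m2], then an avoiding
    extension of [t] by one more bit than their maximum would pass through one of them. *)
Lemma avoids_path D s :
  (forall m, exists2 t, size t = m & avoids D (s ++ t)) ->
  exists x, cprefix x (size s) = s /\ forall n, ~ D (cprefix x n).
Proof.
pose Q s := forall m, exists2 t, size t = m & avoids D (s ++ t).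
move=> Qs; have [|x [xs xQ]] := @path_exists Q s _ Qs; last first.
  exists x; split=> //; apply/avoids_cprefix => n.
  have [t _] := xQ (maxn (size s) n) (leq_maxl _ _) 0.
  move=> /avoids_catl; rewrite -[cprefix x (maxn _ _)](cat_take_drop n).
  by move=> /avoids_catl; rewrite take_cprefix ?leq_maxr.
move=> t Qt; apply: contrapT => nQ.
have H b : exists m, forall t', size t' = m -> ~ avoids D (rcons t b ++ t').
  apply: contrapT => H; apply: nQ; exists b => m; apply: contrapT => Hm.
  by apply: H; exists m => t' st' at'; apply: Hm; exists t'.
have [m1 Hm1] := H true; have [m2 Hm2] := H false.
have [[|b t'] //= [st'] at'] := Qt (maxn m1 m2).+1.
have Hb m : m <= maxn m1 m2 -> exists2 t', size t' = m & avoids D (rcons t b ++ t').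
  move=> Hm; exists (take m t'); first by rewrite size_takel // st'.
  apply: (@avoids_catl _ _ (drop m t')).
  by rewrite -catA cat_take_drop cat_rcons.
case: b Hb {at'} => [/(_ m1 (leq_maxl _ _))|/(_ m2 (leq_maxr _ _))] [r sr ar].
  exact: Hm1 sr ar.
exact: Hm2 sr ar.
Qed.

(** This is $|t|-K(t)\geq c$, witnessed by a program instead of an infimum, so that it is visibly
    c.e. *)
Definition deficient (U : mu_code) (c : nat) (t : seq bool) : Prop :=
  exists2 p, runs U p t & size p + c <= size t.

Section Deficiency.
Variables (U : mu_code) (c : nat) (B : seq nat -> nat).
Hypothesis simB : stage_simulation 1 U B.

(** The string has length [i] and number [z], and [p] is the number of a program. The last conjunct
    says that this program has at most [i - c] bits; [c <= i] guards the truncated subtraction. *)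
Definition deficient_by (t i z : nat) : bool :=
  [exists p : 'I_t, [&& c <= i, B [:: t; val p] == z.+1 & p.+1 < 2 ^ (i - c).+1]].

Lemma leq_deficient_by t t' i z :
  t <= t' -> deficient_by t i z -> deficient_by t' i z.
Proof.
move=> tt' /existsP [p /and3P[ci /eqP Bp pi]]; apply/existsP.
exists (widen_ord tt' p); rewrite ci pi andbT /=; apply/eqP.
by case: simB => _ _ mB; apply: mB Bp.
Qed.

Lemma deficientP s : deficient U c s <-> exists t, deficient_by t (size s) (strn s).
Proof.
case: simB => _ eB mB; split.
  move=> [p /(eB [:: strn p] _ erefl) [t Ht] sp].
  exists (maxn t (strn p).+1); apply/existsP.
  exists (Ordinal (leq_maxr t (strn p).+1)) => /=.
  have -> : c <= size s by lia.
  rewrite (mB [:: strn p] _ _ _ erefl (leq_maxl _ _) Ht) eqxx /=.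
  have /andP[_ Hp] := strn_bounds p; apply: leq_trans Hp _.
  by rewrite leq_exp2l //; lia.
move=> [t /existsP [p /and3P[ci /eqP Bp pi]]]; exists (str p).
  by apply/eB => //; exists t; rewrite strK.
have /andP[Hp _] := strn_bounds (str p); rewrite strK in Hp.
have := leq_ltn_trans Hp pi; rewrite ltn_exp2l //; lia.
Qed.

Lemma deficient_by_decidable a t i z :
  calculable a t -> calculable a i -> calculable a z ->
  decidable_on a (fun v => deficient_by (t v) (i v) (z v)).
Proof.
move=> ct ci cz; case: simB => cB _ _.
apply: (@decidable_exists a (fun p v => [&& c <= i v, B [:: t v; p] == (z v).+1
  & p.+1 < 2 ^ (i v - c).+1])) => //.
have ci' := calculable_behead ci.
apply: decidable_and; first exact: decidable_leq (calculable_const _ _) ci'.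
apply: decidable_and.
  apply: decidable_eq; last exact/calculable_succ/calculable_behead.
  apply: (calculable_comp2 (f := fun t p => B [:: t; p])); last exact: calculable_nth.
    by apply: eq_calculable cB => -[|? [|? []]].
  exact: calculable_behead.
apply: decidable_leq; first exact/calculable_succ/calculable_succ/calculable_nth.
apply: calculable_exp; first exact: calculable_const.
exact/calculable_succ/(calculable_sub ci')/calculable_const.
Qed.

End Deficiency.

Lemma modn_exp2_addr i n r q : i <= n -> (r + q * 2 ^ n) %% 2 ^ i = r %% 2 ^ i.
Proof. by move=> /subnK <-; rewrite expnD mulnA addnC modnMDl. Qed.

(* If the [c]-incompressible strings compatible with [x] were effectively null,
   then [effectively_null_compressible] would compress a prefix of [x]. *)
Lemma incompressible_count U c x j : optimal_prefix_free U ->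
  (forall n, ~ deficient U c (cprefix x n)) ->
  exists k, forall n, j <= n ->
    2 ^ n <= 2 ^ k * \sum_(r < 2 ^ n)
      ((r %% 2 ^ j == bnum (cprefix x j)) && `[< avoids (deficient U c) (bstr n r) >]).
Proof.
move=> optU Hx; have [B simB] := simulation_exists 1 U.
pose dby := deficient_by c B.
pose ext r := r %% 2 ^ j == bnum (cprefix x j).
(* The number [2 ^ i - 1 + r %% 2 ^ i] is that of the prefix of length [i]. The parameter [t] serves
   both as the stage and, in [cnt], as the length of the strings. *)
pose sfree t r := [forall i : 'I_t.+1, ~~ dby t i (2 ^ i - 1 + r %% 2 ^ i)].
pose cnt t := \sum_(r < 2 ^ t) (ext r && sfree t r).
apply: contrapT => Hcontra.
have exs k : exists t, (j <= t) && (cnt t * 2 ^ (2 * k) <= 2 ^ t).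
  have [n jn Hn] : exists2 n, j <= n & 2 ^ (2 * k) * \sum_(r < 2 ^ n)
      (ext r && `[< avoids (deficient U c) (bstr n r) >]) <= 2 ^ n.
    apply: contrapT => H; apply: Hcontra; exists (2 * k) => n jn.
    by rewrite leqNgt; apply/negP => /ltnW H'; apply: H; exists n.
  (* Wait until every deficient string of length at most [n] is seen. Then each survivor of length
     [t] extends an avoiding string of length [n], which has [2 ^ (t - n)] extensions, so the small
     fraction at level [n] is inherited. *)
  have [t0 Ht0] : exists t0, forall i, i < n.+1 -> forall r, r < 2 ^ i ->
      deficient U c (bstr i r) -> dby t0 i (2 ^ i - 1 + r).
    apply: eventually_all => [i t t' tt' Ht r ri Hd|i _].
      exact/(leq_deficient_by simB tt')/Ht.
    apply: (@eventually_all _ (fun t r => deficient U c (bstr i r) -> dby t i (2 ^ i - 1 + r))).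
      by move=> r t t' tt' Ht Hd; apply/(leq_deficient_by simB tt')/Ht.
    move=> r ri; case: (pselect (deficient U c (bstr i r))) => [|nd]; last by exists 0.
    move=> Hd; have /(deficientP c simB) [t Ht] := Hd.
    by exists t => _; move: Ht; rewrite size_bstr // strK.
  pose t := maxn t0 n; have nt : n <= t by rewrite leq_maxr.
  exists t; apply/andP; split; first exact: leq_trans nt.
  have Et : 2 ^ t = 2 ^ (t - n) * 2 ^ n by rewrite -expnD subnK.
  rewrite /cnt Et (sum_ord_mul _ _ (fun r => ext r && sfree t r : nat)).
  apply: leq_trans (_ : _ <= 2 ^ (t - n) * (2 ^ (2 * k) * \sum_(r < 2 ^ n)
      (ext r && `[< avoids (deficient U c) (bstr n r) >]))) _; last first.
    by rewrite leq_pmul2l ?expn_gt0 //; exact: Hn.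
  rewrite [2 ^ (2 * k) * _]mulnC mulnA leq_mul2r; apply/orP; right.
  rewrite -[X in _ <= X * _]card_ord -sum_nat_const; apply: leq_sum => q _.
  apply: leq_sum => r _; rewrite [q * _ + r]addnC.
  have modE i : i <= n -> (r + q * 2 ^ n) %% 2 ^ i = r %% 2 ^ i.
    exact: modn_exp2_addr.
  rewrite {1}/ext modE // -/(ext r); case: (ext r) => //=.
  case: asboolP => [_|nav]; first exact: leq_b1.
  case: (boolP (sfree _ _)) => // /forallP Hs; case: nav => i.
  wlog iN : i / i <= n.
    move=> H; have [|/ltnW ni] := leqP i n; first exact: H.
    by have := H n (leqnn n); rewrite !take_oversize ?size_bstr.
  rewrite take_bstr // => Hd.
  have it : i < t.+1 by rewrite ltnS; apply: leq_trans nt.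
  have /negP := Hs (Ordinal it); apply; rewrite /= modE //.
  apply: (leq_deficient_by simB (leq_maxl t0 n)); apply: Ht0 => //.
  by rewrite ltn_mod expn_gt0.
(* The condition on [t] is decidable, so its least solution is computable in [k]. *)
pose s k := ex_minn (exs k).
have Hs k : j <= s k /\ cnt (s k) * 2 ^ (2 * k) <= 2 ^ s k.
  by rewrite /s; case: ex_minnP => t /andP[].
have c_ext a r : calculable a r -> decidable_on a (fun v => ext (r v)).
  move=> cr; apply: decidable_eq; last exact: calculable_const.
  by apply: calculable_mod cr _; apply: calculable_const.
have c_sfree a t r : calculable a t -> calculable a r ->
    decidable_on a (fun v => sfree (t v) (r v)).
  move=> ct cr; apply: (@decidable_forall a
    (fun i v => ~~ dby (t v) i (2 ^ i - 1 + r v %% 2 ^ i)) (fun v => (t v).+1)).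
    apply: decidable_neg; apply: (deficient_by_decidable c simB).
    - exact: calculable_behead.
    - exact: calculable_nth.
    have c2i : calculable a.+1 (fun w => 2 ^ nth 0 w 0).
      exact: calculable_exp (calculable_const _ _) (calculable_nth _ _).
    apply: calculable_add; first exact: calculable_sub c2i (calculable_const _ _).
    exact: calculable_mod (calculable_behead cr) c2i.
  exact: calculable_succ.
have c_A a t r : calculable a t -> calculable a r ->
    decidable_on a (fun v => ext (r v) && sfree (t v) (r v)).
  by move=> ct cr; apply: decidable_and; [apply: c_ext | apply: c_sfree].
have c_s : calculable 1 (fun w => s (nth 0 w 0)).
  apply: (@calculable_least 1 (fun t w => (j <= t) && (cnt t * 2 ^ (2 * nth 0 w 0) <= 2 ^ t))).
  - have c_t := calculable_nth 2 0.
    have c_2t := calculable_exp (calculable_const 2 2) c_t.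
    apply: decidable_and; first exact: decidable_leq (calculable_const _ _) c_t.
    apply: decidable_leq (c_2t); apply: calculable_mul.
      apply: (@calculable_sum 2 (fun r w => ext r && sfree (nth 0 w 0) r)); last exact: c_2t.
      apply: c_A; last exact: calculable_nth.
      exact: (calculable_behead (calculable_nth 2 0)).
    apply: calculable_exp; first exact: calculable_const.
    apply: calculable_mul; first exact: calculable_const.
    exact: (calculable_behead (calculable_nth 1 0)).
  - by move=> w; have [H1 H2] := Hs (nth 0 w 0); rewrite H1 H2.
  - move=> w i; rewrite /s; case: ex_minnP => t _ Hmin it.
    by apply/negP => /Hmin; rewrite leqNgt it.
have c_As : decidable_on 2 (fun w =>
    ext (nth 0 w 1) && sfree (s (nth 0 w 0)) (nth 0 w 1)).
  apply: c_A; last exact: calculable_nth.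
  exact: calculable_comp1 c_s (calculable_nth _ _).
have [d Hd] := @effectively_null_compressible (fun k r => ext r && sfree (s k) r) s
  c_As c_s (fun k => (Hs k).2) U optU.
(* The prefix of [x] of length [s k] survives every stage, hence gets a program of at most
   [s k + d - k = s k - c] bits: it is deficient. *)
pose k := d + c; have [jk _] := Hs k.
have rx : bnum (cprefix x (s k)) < 2 ^ s k.
  by have := bnum_lt (cprefix x (s k)); rewrite size_cprefix.
have xs : bstr (s k) (bnum (cprefix x (s k))) = cprefix x (s k).
  by rewrite -{1}(size_cprefix x (s k)) bnumK.
have modx i : i <= s k -> bnum (cprefix x (s k)) %% 2 ^ i = bnum (cprefix x i).
  move=> ik; have := take_bstr ik rx; rewrite xs take_cprefix // => ->.
  by rewrite bstrK // ltn_mod expn_gt0.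
have [||q Uq qk] := Hd k (bnum (cprefix x (s k))) => //.
  rewrite /ext modx // eqxx; apply/forallP => i; apply/negP => Hi.
  have ik : i <= s k by rewrite -ltnS.
  apply: (Hx i); apply/(deficientP c simB); exists (s k).
  rewrite size_cprefix; move: Hi; rewrite modx //; congr dby.
  by rewrite -[in RHS](bnumK (cprefix x i)) size_cprefix strK.
apply: (Hx (s k)); exists q; first by rewrite -xs.
by rewrite size_cprefix; move: qk; rewrite /k; lia.
Qed.

(** An avoiding string may have no avoiding path through it. Choose [m] such that every string of
    length [n] with an avoiding extension by [m] bits has such extensions of all lengths. The count
    at length [m + n] is then at most [2 ^ m] times the number of strings on paths. *)
Lemma incompressible_path_count U c x j : optimal_prefix_free U ->
  (forall n, ~ deficient U c (cprefix x n)) ->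
  exists k, forall n, j <= n ->
    2 ^ n <= 2 ^ k * \sum_(r < 2 ^ n)
      `[< exists y, [/\ forall i, ~ deficient U c (cprefix y i),
           cprefix y j = cprefix x j & cprefix y n = bstr n r] >].
Proof.
move=> optU Hx; have [k Hk] := incompressible_count j optU Hx.
exists k => n jn; pose D := deficient U c.
pose extm m r := exists2 t, size t = m & avoids D (bstr n r ++ t).
have extm_le m m' r : m <= m' -> extm m' r -> extm m r.
  move=> mm' [t st at']; exists (take m t); first by rewrite size_takel // st.
  apply: (@avoids_catl _ _ (drop m t)); by rewrite -catA cat_take_drop.
have [m Hm] : exists m, forall r, r < 2 ^ n -> extm m r -> forall m', extm m' r.
  apply: eventually_all => [r t t' tt' H /(extm_le _ _ _ tt')|r rn]; first exact: H.
  case: (pselect (forall m', extm m' r)) => [H|]; first by exists 0.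
  by move=> /existsNP [m' Hm']; exists m' => /Hm'.
have := Hk (m + n) (leq_trans jn (leq_addl _ _)); rewrite expnD.
rewrite (sum_ord_mul _ _ (fun r => (r %% 2 ^ j == bnum (cprefix x j))
  && `[< avoids (deficient U c) (bstr (m + n) r) >] : nat)) => Hc.
rewrite -(leq_pmul2l (expn_gt0 2 m)); apply: leq_trans Hc _.
rewrite [leqRHS]mulnCA leq_mul2l; apply/orP; right.
rewrite -[X in _ <= X * _]card_ord -sum_nat_const; apply: leq_sum => q _.
apply: leq_sum => r _; rewrite [q * _ + r]addnC [m + n]addnC.
case: asboolP => [av|]; last by rewrite andbF.
case: eqP => //= Hr; case: asboolP => // -[].
have Hav : extm m r.
  exists (bstr m q); first by rewrite size_bstr.
  by rewrite bstr_cat // [2 ^ n * q]mulnC.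
have [y [yn Hy]] := avoids_path (Hm _ (ltn_ord r) Hav).
rewrite size_bstr // in yn; exists y; split=> //.
rewrite -(take_cprefix y jn) yn take_bstr //.
rewrite -[RHS]bnumK size_cprefix; congr bstr.
by rewrite -Hr modn_exp2_addr.
Qed.

(** * Semimeasures *)

Section Pushforward.
Variables (code : nat -> nat -> nat) (lvl w N : nat -> nat).

Definition is_jump (L : nat) : bool := (L == 0) || (w L.-1 < w L).

(* The uniform distribution on [u < 2 ^ N L] is pushed forward by [code L] and
   given total mass [2 ^ - (w L).+1] on level [L], provided that [L] is a jump
   of [w]; the jumps have distinct values of [w], so the masses add up to at
   most [1]. *)
Definition pushforward_num (z : nat) : nat :=
  is_jump (lvl z) * \sum_(u < 2 ^ N (lvl z)) (code (lvl z) u == z).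

Definition pushforward_exp (z : nat) : nat := (w (lvl z)).+1 + N (lvl z).

Definition pushforward (R : realType) (s : seq bool) : R :=
  ((pushforward_num (strn s))%:R / 2 ^+ pushforward_exp (strn s))%R.

Lemma pushforward_ge0 (R : realType) s : (0 <= pushforward R s)%R.
Proof. by rewrite divr_ge0 ?ler0n ?exprn_ge0. Qed.

Lemma sum_jumps (R : realType) (M : nat) : {homo w : i j / i <= j} ->
  (\sum_(L < M) (is_jump L)%:R / 2 ^+ (w L).+1 <= 1 :> R)%R.
Proof.
move=> w_homo; case: M => [|M]; first by rewrite big_ord0.
(* The strengthened bound telescopes: at a jump the exponent grows by at least one, so the new mass
   is at most half of the remaining gap. *)
suff : (\sum_(L < M.+1) (is_jump L)%:R / 2 ^+ (w L).+1 <= 1 - (2 ^+ (w M).+1)^-1 :> R)%R.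
  by move/le_trans; apply; rewrite gerBl invr_ge0 exprn_ge0.
elim: M => [|M IH].
  rewrite big_ord1 /is_jump /= mul1r lerBrDr -mulr2n -[(_ *+ 2)%R]mulr_natr exprS.
  rewrite invfM mulrAC mulVf // mul1r invf_le1 ?exprn_gt0 //.
  by rewrite exprn_ege1 // ler1n.
rewrite big_ord_recr /=; apply: le_trans (lerD IH (lexx _)) _.
rewrite /is_jump /=; case: ltnP => [H|H]; last first.
  have -> : w M.+1 = w M by apply/eqP; rewrite eqn_leq H w_homo.
  by rewrite mul0r addr0.
have : ((2 ^+ (w M.+1).+1)^-1 + (2 ^+ (w M.+1).+1)^-1 <= (2 ^+ (w M).+1)^-1 :> R)%R.
  rewrite -mulr2n -[(_ *+ 2)%R]mulr_natr exprS invfM mulrAC mulVf // mul1r.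
  by rewrite lef_pV2 ?posrE ?exprn_gt0 // ler_eXn2l // ltr1n.
move: (_ ^-1)%R (_ ^-1)%R => x y; rewrite mul1r; lra.
Qed.

Lemma sum_pushforward (R : realType) (r : seq (seq bool)) :
  {homo w : i j / i <= j} -> uniq r -> (\sum_(s <- r) pushforward R s <= 1)%R.
Proof.
move=> w_homo ur.
pose M := (\max_(s <- r) lvl (strn s)).+1.
apply: le_trans (sum_jumps R M w_homo).
rewrite (eq_big_seq (fun s => \sum_(L < M) (lvl (strn s) == L)%:R * pushforward R s)%R).
  rewrite exchange_big /=; apply: ler_sum => L _.
  have H s : ((lvl (strn s) == L)%:R * pushforward R s <=
      (is_jump L)%:R / 2 ^+ ((w L).+1 + N L) * \sum_(u < 2 ^ N L) (code L u == strn s)%:R)%R.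
    case: eqP => [E|_]; last first.
      by rewrite mul0r !mulr_ge0 ?ler0n ?invr_ge0 ?exprn_ge0 ?sumr_ge0.
    rewrite mul1r /pushforward /pushforward_exp /pushforward_num E natrM -natr_sum.
    by rewrite mulrAC.
  apply: (le_trans (ler_sum _ (fun s _ => H s))); rewrite -mulr_sumr exchange_big /=.
  rewrite exprD invfM mulrA -[leRHS]mulr1 -[leLHS]mulrA.
  apply: ler_wpM2l; first by rewrite mulr_ge0 ?ler0n ?invr_ge0 ?exprn_ge0.
  rewrite mulrC ler_pdivrMr ?exprn_gt0 // mul1r.
  apply: le_trans (_ : (\sum_(u < 2 ^ N L) 1 <= _)%R); last first.
    by rewrite sumr_const card_ord natrX.
  apply: ler_sum => u _; rewrite -natr_sum lern1.
  (* Each [u] is sent to at most one string of the duplicate-free list [r]. *)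
  have [/hasP [s0 s0r /eqP E]|/hasPn H0] := boolP (has (fun s => code L u == strn s) r).
    rewrite (bigD1_seq s0) //= E eqxx big1 // => s ne.
    by case: (strn s0 =P strn s) ne => // /strn_inj ->; rewrite eqxx.
  by rewrite big_seq big1 // => s /H0; case: eqP.
move=> s sr /=; have HM : lvl (strn s) < M by rewrite ltnS leq_bigmax_seq.
rewrite (bigD1 (Ordinal HM)) //= eqxx mul1r big1 ?addr0 // => L.
by rewrite -val_eqE /= eq_sym => /negPf ->; rewrite mul0r.
Qed.

Lemma pushforward_semimeasure (R : realType) :
  {homo w : i j / i <= j} -> semimeasure (pushforward R).
Proof.
move=> w_homo; split; first exact: pushforward_ge0.
apply: ge_ereal_sup => _ [A [finA _] <-].
rewrite fsbig_finite //= sumEFin lee_fin.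
exact: sum_pushforward (fset_uniq _).
Qed.

Lemma pushforward_lower_semicomputable (R : realType) :
  calculable 2 (fun v => code (nth 0 v 0) (nth 0 v 1)) ->
  calculable 1 (fun v => lvl (nth 0 v 0)) -> calculable 1 (fun v => w (nth 0 v 0)) ->
  calculable 1 (fun v => N (nth 0 v 0)) -> lower_semicomputable (pushforward R).
Proof.
move=> c_code c_lvl c_w c_N.
have c_L : calculable 2 (fun v => lvl (nth 0 v 0)).
  exact: calculable_comp1 c_lvl (calculable_nth _ _).
(* The values are computable dyadic rationals, so a constant approximation suffices; the [- 1]
   cancels the successor in the denominator that [lower_semicomputable] prescribes. *)
exists (fun z _ => pushforward_num z), (fun z _ => 2 ^ pushforward_exp z - 1); split.
- apply/computable2P; apply: calculable_mul.
    apply: decidable_or; first exact: decidable_eq c_L (calculable_const _ _).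
    apply: decidable_leq; last exact: calculable_comp1 c_w c_L.
    exact/calculable_succ/(calculable_comp1 c_w)/calculable_pred.
  apply: (@calculable_sum 2 (fun u v => code (lvl (nth 0 v 0)) u == nth 0 v 0)).
    have c_z := calculable_behead (calculable_nth 2 0).
    apply: decidable_eq c_z; apply: calculable_comp2 c_code _ (calculable_nth _ _).
    exact: calculable_behead c_L.
  apply: calculable_exp; first exact: calculable_const.
  exact: calculable_comp1 c_N c_L.
- apply/computable2P; apply: calculable_sub (calculable_const _ _).
  apply: calculable_exp; first exact: calculable_const.
  apply: calculable_add; last exact: calculable_comp1 c_N c_L.
  exact/calculable_succ/(calculable_comp1 c_w).
- move=> s q; have -> : q = fun=> pushforward R s.
    apply/funext => k; rewrite /q /pushforward -natrX.
    by rewrite subn1 prednK ?expn_gt0.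
  by split; [move=> i j _ | exact: cvg_cst].
Qed.

(** The count on the left is the pushforward mass of [A], rescaled. What matters is that a single
    [C] serves all levels. *)
Lemma pushforward_le_optimal (R : realType) (m : seq bool -> R) :
  optimal_semimeasure m -> {homo w : i j / i <= j} ->
  calculable 2 (fun v => code (nth 0 v 0) (nth 0 v 1)) ->
  calculable 1 (fun v => lvl (nth 0 v 0)) -> calculable 1 (fun v => w (nth 0 v 0)) ->
  calculable 1 (fun v => N (nth 0 v 0)) ->
  exists2 C : R, (0 < C)%R & forall L (A : set (seq bool)), is_jump L -> finite_set A ->
    (forall s, A s -> lvl (strn s) = L) ->
    ((\sum_(u < 2 ^ N L) `[< exists2 s, A s & strn s = code L u >] : nat)%N%:R <=
     C * 2 ^+ ((w L).+1 + N L) * \sum_(s \in A) m s)%R.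
Proof.
move=> [_ _ opt] w_homo c_code c_lvl c_w c_N.
have [C C0 HC] := opt _ (pushforward_semimeasure R w_homo)
  (pushforward_lower_semicomputable R c_code c_lvl c_w c_N).
exists C => // L A jL finA lvlA.
rewrite fsbig_finite //= mulrAC mulr_sumr.
apply: le_trans (_ : _ <= (\sum_(s <- fset_set A) pushforward R s)
  * 2 ^+ ((w L).+1 + N L))%R _; last first.
  by apply: ler_wpM2r; rewrite ?exprn_ge0 //; apply: ler_sum => s _.
have -> : ((\sum_(s <- fset_set A) pushforward R s) * 2 ^+ ((w L).+1 + N L) =
    (\sum_(s <- fset_set A) \sum_(u < 2 ^ N L) (code L u == strn s) : nat)%N%:R :> R)%R.
  rewrite natr_sum mulr_suml; apply: eq_big_seq => s.
  rewrite in_fset_set // => /set_mem /lvlA E.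
  by rewrite /pushforward /pushforward_exp /pushforward_num E jL mul1n divfK //.
rewrite ler_nat exchange_big /=; apply: leq_sum => u _.
case: asboolP => // -[s As E]; rewrite (bigD1_seq s) ?fset_uniq //= -?E ?eqxx //.
by rewrite in_fset_set // mem_set.
Qed.

End Pushforward.

(** * Pruned trees *)

Lemma tree_take (T : pruned_tree) n s : tree_set T s -> tree_set T (take n s).
Proof. by case: (tree_setP T) => _ H; apply: H; apply: prefix_take. Qed.

Lemma pruned_path (T : pruned_tree) s : tree_set T s ->
  exists x, cprefix x (size s) = s /\ forall n, tree_set T (cprefix x n).
Proof.
move=> Ts; have [|x [xs Hx]] := @path_exists (tree_set T) s _ Ts.
  move=> t Tt; have [u [Tu /prefixP [v E] tu]] := tree_pruned Tt.
  case: v E => [|b v] E; first by case: tu; rewrite E cats0.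
  exists b; have := tree_take (size t).+1 Tu.
  by rewrite E -cat_rcons take_size_cat // size_rcons.
exists x; split=> // n; have [/Hx //|/ltnW ns] := leqP (size s) n.
by rewrite -(take_cprefix x ns) xs; apply: tree_take.
Qed.

Lemma pruned_extend (T : pruned_tree) s n : tree_set T s -> size s <= n ->
  exists t, [/\ tree_set T t, size t = n & take (size s) t = s].
Proof.
move=> /pruned_path [x [xs Hx]] sn; exists (cprefix x n).
by rewrite size_cprefix take_cprefix.
Qed.

Lemma pruned_level (T : pruned_tree) n : exists2 s, tree_set T s & size s = n.
Proof.
have [[s Ts] _] := tree_setP T; have [x [_ Hx]] := pruned_path Ts.
by exists (cprefix x n); rewrite ?size_cprefix.
Qed.

(** A pruned tree has strings of every length, so a truncation reveals its level. This removes the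
    ambiguity of the existential level in the subbasic sets. *)
Lemma trunc_tree_level (T T' : pruned_tree) n n' :
  trunc_tree T n = trunc_tree T' n' -> n = n'.
Proof.
suff H (S S' : pruned_tree) m m' : trunc_tree S m = trunc_tree S' m' -> m <= m'.
  by move=> E; apply/eqP; rewrite eqn_leq (H _ _ _ _ E) (H _ _ _ _ (esym E)).
move=> E; have [s Ss sm] := pruned_level S m; rewrite -sm in E *.
have : trunc_tree S (size s) s by [].
by rewrite E => -[].
Qed.

Lemma trunc_tree_le (T T' : pruned_tree) n m : m <= n ->
  trunc_tree T n = trunc_tree T' n -> trunc_tree T m = trunc_tree T' m.
Proof.
move=> mn E; apply/seteqP; split=> s [Ts sm]; split=> //.
  have : trunc_tree T n s by split=> //; apply: leq_trans mn.
  by rewrite E => -[].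
have : trunc_tree T' n s by split=> //; apply: leq_trans mn.
by rewrite -E => -[].
Qed.

Lemma mem_trunc_tree (T T' : pruned_tree) n s :
  trunc_tree T n = trunc_tree T' n -> size s <= n -> tree_set T s -> tree_set T' s.
Proof.
move=> E sn Ts; have : trunc_tree T n s by [].
by rewrite E => -[].
Qed.

Lemma finite_strings n : finite_set [set s : seq bool | size s <= n].
Proof.
apply: (@sub_finite_set _ _ (str @` `I_(2 ^ n.+1))); last first.
  exact/finite_image/finite_II.
move=> s /= sn; exists (strn s); last exact: strnK.
have /andP[_ H] := strn_bounds s; have : 2 ^ (size s).+1 <= 2 ^ n.+1.
  by rewrite leq_exp2l.
rewrite /=; lia.
Qed.

Section PathTree.
Variables (Y : set cantor_space) (Y0 : Y !=set0).

Definition path_tree_set : set (seq bool) :=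
  [set s | exists2 y, Y y & cprefix y (size s) = s].

Lemma path_tree_is_tree : is_tree path_tree_set.
Proof.
split; first by have [y Yy] := Y0; exists [::], y.
move=> s _ /prefixP [t ->] [y Yy E]; exists y => //.
by rewrite -(take_cprefix y (_ : _ <= size (s ++ t))) ?E ?take_size_cat // size_cat leq_addr.
Qed.

Lemma path_tree_is_pruned : is_pruned path_tree_set.
Proof.
move=> s [y Yy E]; exists (cprefix y (size s).+1); split.
- by exists y; rewrite // size_cprefix.
- by rewrite prefixE take_cprefix ?E.
- by move=> /(congr1 size); rewrite size_cprefix; lia.
Qed.

Definition path_tree : pruned_tree :=
  PrunedTree path_tree_is_tree path_tree_is_pruned.

Lemma cprefix_path_tree y n : Y y -> tree_set path_tree (cprefix y n).
Proof. by move=> Yy; exists y; rewrite // size_cprefix. Qed.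

End PathTree.

Definition avoiding (D : seq bool -> Prop) (T : set (seq bool)) : Prop :=
  forall s, T s -> ~ D s.

Lemma is_incompressibleP (R : realType) U c T :
  is_incompressible R U c T <-> avoiding (deficient U c) T.
Proof.
split=> [H s Ts [p Up pc]|H]; rewrite /is_incompressible.
  move: H; apply/negP; rewrite -leNgt; apply: le_trans (_ : _ <=
    ((size s)%:R - (size p)%:R)%:E)%E _.
    by rewrite lee_fin lerBrDl -natrD ler_nat.
  apply: le_trans (ereal_sup_ubound (_ : _ ((size s)%:R%:E - K R U s)%E)); last by exists s.
  by rewrite EFinB; apply: leeB => //; apply: ereal_inf_lbound; exists p.
(* Lengths are integers, so every difference below [c] is at most [c - 1]; this keeps the supremum
   strictly below [c]. *)
apply: (@le_lt_trans _ _ (c%:R - 1)%:E%R); last by rewrite lte_fin ltrBlDr ltrDl ltr01.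
apply: ge_ereal_sup => _ [s Ts <-].
have HK : (((size s)%:R + 1 - c%:R)%:E <= K R U s)%E.
  apply: le_ereal_inf_tmp => _ [p Up <-]; rewrite lee_fin lerBlDr natr1 -natrD ler_nat.
  by rewrite ltnNge; apply/negP => Hp; apply: (H s Ts); exists p.
apply: le_trans (leeB (lexx _) HK) _.
by rewrite -EFinB lee_fin; lra.
Qed.

(** * The topology of pruned trees *)

Lemma open_pruned_tree (O : set pruned_tree) : open O <->
  forall T, O T -> exists n, forall T' : pruned_tree,
    trunc_tree T' n = trunc_tree T n -> O T'.
Proof.
split=> [[D' sD' <-] T [A D'A AT]|H].
  have [Fs sFs EA] := sD' _ D'A; rewrite -EA in D'A AT *.
  have HF F : exists n, F \in Fs -> F = trunc_tree T n.
    case: (boolP (F \in Fs)) => [FFs|_]; last by exists 0.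
    by have [n Hn] := AT F FFs; exists n.
  have [f Hf] := choice HF.
  (* Truncations of one tree are nested, so the highest of the finitely many levels decides all the
     subbasic conditions. *)
  exists (\max_(F <- Fs) f F) => T' ET'.
  exists (\bigcap_(i in [set` Fs]) [set T : pruned_tree | exists n, i = trunc_tree T n]) => //.
  move=> F FFs; exists (f F); rewrite {1}(Hf F FFs); apply/esym.
  by apply: trunc_tree_le ET'; apply: leq_bigmax_seq.
pose cyl (x : pruned_tree * nat) := [set T' : pruned_tree | trunc_tree T' x.2 = trunc_tree x.1 x.2].
have -> : O = \bigcup_(x in [set x | cyl x `<=` O]) cyl x.
  apply/seteqP; split=> [T OT|T [x xO xT]]; last exact: xO.
  by have [n Hn] := H T OT; exists (T, n).
apply: bigcup_open => -[T n] _.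
have -> : cyl (T, n) = [set T' : pruned_tree | exists n', trunc_tree T n = trunc_tree T' n'].
  apply/seteqP; split=> T'; first by rewrite /cyl /= => <-; exists n.
  by move=> [n' E]; rewrite /cyl /= E (trunc_tree_level E).
exists [set [set T' : pruned_tree | exists n', trunc_tree T n = trunc_tree T' n']]; last first.
  by rewrite bigcup_set1.
move=> _ ->; apply: (@finI_from1 _ _ _
  (fun F => [set T' : pruned_tree | exists n', F = trunc_tree T' n'])).
split; first by apply: (sub_finite_set _ (finite_strings n)) => s [].
have [s0 Ts0 s0n] := pruned_level T 0.
split; first by exists s0; split; rewrite // s0n.
move=> s t st [Tt tn]; split; first by have [_ /(_ s t st Tt)] := tree_setP T.
exact: leq_trans (size_prefix st) tn.
Qed.

Lemma open_set_type_pruned_tree (S : set pruned_tree) (A : set S) : open A <->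
  forall T : S, A T -> exists n, forall T' : S,
    trunc_tree (val T') n = trunc_tree (val T) n -> A T'.
Proof.
split=> [[V /open_pruned_tree oV <-] T /oV [n Hn]|H].
  by exists n => T' E; apply: Hn.
exists [set T : pruned_tree | exists (T0 : S) n, trunc_tree T n = trunc_tree (val T0) n /\
    forall T' : S, trunc_tree (val T') n = trunc_tree (val T0) n -> A T'].
  apply/open_pruned_tree => T [T0 [n [E HA]]]; exists n => T' E'.
  by exists T0, n; rewrite E'.
apply/seteqP; split=> T; first by move=> [T0 [n [E HA]]]; apply: HA.
by move=> AT; have [n Hn] := H T AT; exists T, n.
Qed.

Lemma dense_set_type_pruned_tree (S : set pruned_tree) (A : set S) :
  (forall (T : S) n, exists T' : S, trunc_tree (val T') n = trunc_tree (val T) n /\ A T') ->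
  dense A.
Proof.
move=> H O [T OT] /open_set_type_pruned_tree /(_ T OT) [n Hn].
by have [T' [E AT']] := H T n; exists T'; split=> //; apply: Hn.
Qed.

(** * Perfect incompressible trees *)

(** Perfectness at a single string. The witnesses lie in a finite truncation, so perfectness becomes
    a countable intersection of open conditions. *)
Definition splits (T : set (seq bool)) (s : seq bool) : Prop :=
  exists t u, [/\ T t, T u, prefix s t /\ s <> t, prefix s u /\ s <> u
    & ~~ prefix t u /\ ~~ prefix u t].

Lemma open_splits (S : set pruned_tree) s :
  open [set T : S | tree_set (val T) s -> splits (val T) s].
Proof.
apply/open_set_type_pruned_tree => T; case: (pselect (tree_set (val T) s)) => [Ts|nTs].
  move=> /(_ Ts) [t [u [Tt Tu st su tu]]].
  exists (maxn (size t) (size u)) => T' E Ts'; exists t, u; split=> //.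
    by apply: (mem_trunc_tree (esym E)) Tt; rewrite leq_maxl.
  by apply: (mem_trunc_tree (esym E)) Tu; rewrite leq_maxr.
move=> _; exists (size s) => T' E Ts'; case: nTs.
exact: (mem_trunc_tree E).
Qed.

Lemma prefix_same_size (s t : seq bool) : size s = size t -> prefix s t -> s = t.
Proof. by move=> st; rewrite prefixE st take_size => /eqP. Qed.

(** The new tree has all incompressible paths through the strings of [T] at level [n]; the paths of
    [T] itself show that none of these strings is lost. *)
Lemma perfect_extension U c (T : pruned_tree) n :
  optimal_prefix_free U -> avoiding (deficient U c) T ->
  exists T' : pruned_tree, [/\ avoiding (deficient U c) T',
    trunc_tree T' n = trunc_tree T n & forall s, tree_set T' s -> splits T' s].
Proof.
move=> optU avT.
pose Y := [set y : cantor_space |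
  (forall i, ~ deficient U c (cprefix y i)) /\ tree_set T (cprefix y n)].
have YT s : tree_set T s -> size s = n -> exists2 y, Y y & cprefix y n = s.
  move=> /pruned_path [y [ys Hy]] sn; exists y; last by rewrite -sn.
  by split=> // i; apply: avT.
have Y0 : Y !=set0.
  by have [s Ts sn] := pruned_level T n; have [y Yy _] := YT s Ts sn; exists y.
exists (path_tree Y0); split.
- by move=> s [y [Hy _] <-].
- apply/seteqP; split=> s [Ts sn]; split=> //.
    have [y [_ Ty] <-] := Ts; rewrite -(take_cprefix y sn).
    exact: tree_take.
  have [t [Tt tn <-]] := pruned_extend Ts sn; have [y Yy <-] := YT t Tt tn.
  by rewrite take_cprefix //; apply: cprefix_path_tree.
- move=> s [y [Hy Ty] ys].
  (* Agreement with [y] up to [j] puts an incompressible path into [Y] and above [s]. After [k.+1]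
     more bits the bound leaves at least two strings, which are incomparable since they have equal
     length. *)
  pose j := maxn n (size s); have [k Hk] := incompressible_path_count j optU Hy.
  pose L := j + k.+1; have jL : j <= L by rewrite leq_addr.
  have sj : size s <= j by rewrite leq_maxr.
  have nj : n <= j by rewrite leq_maxl.
  pose ok r := `[< exists z, [/\ forall i, ~ deficient U c (cprefix z i),
           cprefix z j = cprefix y j & cprefix z L = bstr L r] >].
  have : 1 < \sum_(r < 2 ^ L) (ok r : nat).
    rewrite -(ltn_pmul2l (expn_gt0 2 k)) muln1.
    by apply: leq_trans (Hk L jL); rewrite ltn_exp2l // /L; lia.
  move=> Hsum; have [r1 r1ok] : exists r : 'I_(2 ^ L), ok r.
    apply: contrapT => H; move: Hsum; rewrite big1 // => r _.
    by apply/eqP; rewrite eqb0; apply/negP => Hr; apply: H; exists r.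
  have [r2 r2ok r12] : exists2 r : 'I_(2 ^ L), ok r & r != r1.
    apply: contrapT => H; move: Hsum; rewrite (bigD1 r1) //= r1ok big1 // => r rr1.
    by apply/eqP; rewrite eqb0; apply/negP => Hr; apply: H; exists r.
  have Hr r : ok r -> r < 2 ^ L ->
      [/\ path_tree_set Y (bstr L r), prefix s (bstr L r) & s <> bstr L r].
    move=> /asboolP [z [Hz zj zL]] rL; rewrite -zL; split.
    - apply: (@cprefix_path_tree _ Y0); split=> //.
      by rewrite -(take_cprefix z nj) zj take_cprefix.
    - by rewrite prefixE take_cprefix ?(leq_trans sj) // -(take_cprefix z sj) zj take_cprefix // ys.
    - by move=> /(congr1 size); rewrite size_cprefix /L; lia.
  have [t1 p1 n1] := Hr r1 r1ok (ltn_ord r1); have [t2 p2 n2] := Hr r2 r2ok (ltn_ord r2).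
  exists (bstr L r1), (bstr L r2); split=> //.
  have bneq : bstr L r1 != bstr L r2.
    apply: contraNneq r12 => /(congr1 bnum); rewrite !bstrK // => E.
    by apply/eqP/val_inj.
  by split; apply: contra bneq => /prefix_same_size ->; rewrite ?size_bstr.
Qed.

(** * Codes of trees and enumeration of classes *)

Section Coding.
Variables (e : set (seq bool) -> seq bool) (he : tree_coding e).

(** Codes of successive truncations are nested; equal lengths would make them equal, and injectivity
    would then identify two different levels. *)
Lemma coding_size_ltn (p : nat -> nat) (T0 : pruned_tree) :
  (forall (T : pruned_tree) n, size (e (trunc_tree T n)) = p n) ->
  {homo p : i j / i < j}.
Proof.
have [_ inj pre _] := he; move=> sp; apply: homo_ltn; first exact: ltn_trans.
move=> n; have H := pre T0 T0 n n.+1 (leqnSn n) erefl.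
rewrite ltn_neqAle -!(sp T0) size_prefix // andbT; apply/eqP => E.
have /inj /trunc_tree_level := prefix_same_size E H; lia.
Qed.

Lemma code_exists (T : pruned_tree) : exists x, code_of e T x.
Proof.
have [[p _ sp] _ pre _] := he; have p_ltn := coding_size_ltn T sp.
have p_ge n : n <= p n.
  by elim: n => [//|n IH]; apply: leq_ltn_trans IH _; apply: p_ltn.
(* The code of the truncation at level [i.+1] has more than [i] bits, so the default [false] is
   never read. *)
pose x : cantor_space := fun i => nth false (e (trunc_tree T i.+1)) i.
exists x => n; apply: (@eq_from_nth _ false); rewrite ?size_cprefix // => i Hi.
rewrite nth_mkseq // /x.
have nth_pre a b : a <= b -> i < p a ->
    nth false (e (trunc_tree T a)) i = nth false (e (trunc_tree T b)) i.
  move=> ab ia; have /prefixP [t ->] := pre T T a b ab erefl.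
  by rewrite nth_cat sp ia.
have [ni|ni] := leqP n i.+1; first by apply: nth_pre => //; rewrite -(sp T).
by apply/esym/nth_pre; [exact: ltnW | exact: p_ge].
Qed.

(** Nonmembership is witnessed by an enumerated prefix of some length [n] of the code. As
    [n <= p n], all trees with the same truncation at level [n] share this prefix. *)
Lemma open_not_tree_member (S : set pruned_tree) P : pi01_class P ->
  open [set T : S | ~ tree_member e (val T) P].
Proof.
move=> [W _ ->]; apply/open_set_type_pruned_tree => T nT.
have [[p _ sp] _ pre _] := he; have p_ltn := coding_size_ltn (val T) sp.
have [x Tx] := code_exists (val T).
have [n Wn] : exists n, W (cprefix x n).
  apply: contrapT => H; apply: nT; exists x => // n Wn; apply: H; by exists n.
have p_ge : n <= p n.
  by elim: (n) => [//|m IH]; apply: leq_ltn_trans IH _; apply: p_ltn.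
exists n => T' E [x' Tx' Px']; apply: (Px' n).
rewrite -(take_cprefix x' p_ge); have := Tx' n; rewrite sp => <-.
by rewrite E Tx sp take_cprefix.
Qed.

End Coding.

Fixpoint mu_code_tree (c : mu_code) : GenTree.tree nat :=
  match c with
  | Zero => GenTree.Leaf 0
  | Succ => GenTree.Leaf 1
  | Proj i => GenTree.Leaf i.+2
  | Comp f gs => GenTree.Node 0 (mu_code_tree f :: map mu_code_tree gs)
  | Prec f g => GenTree.Node 1 [:: mu_code_tree f; mu_code_tree g]
  | Mu f => GenTree.Node 2 [:: mu_code_tree f]
  end.

Fixpoint tree_mu_code (t : GenTree.tree nat) : mu_code :=
  match t with
  | GenTree.Leaf 0 => Zero
  | GenTree.Leaf 1 => Succ
  | GenTree.Leaf i.+2 => Proj i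
  | GenTree.Node 0 (f :: gs) => Comp (tree_mu_code f) (map tree_mu_code gs)
  | GenTree.Node 1 [:: f; g] => Prec (tree_mu_code f) (tree_mu_code g)
  | GenTree.Node 2 [:: f] => Mu (tree_mu_code f)
  | _ => Zero
  end.

Lemma mu_code_treeK : cancel mu_code_tree tree_mu_code.
Proof.
elim/mu_code_nested_ind => //= [f gs -> Hgs|f g -> ->|f ->] //; congr Comp.
by elim: gs Hgs => [//|g gs IH] [/= -> /IH ->].
Qed.

Lemma mu_code_enumeration : exists f : nat -> mu_code, forall c, exists n, f n = c.
Proof.
exists (fun n => if choice.unpickle n is Some t then tree_mu_code t else Zero) => c.
by exists (choice.pickle (mu_code_tree c)); rewrite choice.pickleK mu_code_treeK.
Qed.

(** * Trees spanned by tuples of strings *)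

(* A number [u < (2 ^ n) ^ k] stands for the [k]-tuple of the strings
   [bstr n (digit n u i)], [i < k]. *)
Definition digit (n u i : nat) : nat := u %/ (2 ^ n) ^ i %% 2 ^ n.

Lemma digit_lt n u i : digit n u i < 2 ^ n.
Proof. by rewrite ltn_mod expn_gt0. Qed.

(** The digits of a uniformly chosen [u] are independent, so the measure of a product of conditions
    is the product of the measures. *)
Lemma sum_digits k n (F : nat -> nat -> nat) :
  \sum_(u < (2 ^ n) ^ k) \prod_(i < k) F i (digit n u i) = \prod_(i < k) \sum_(r < 2 ^ n) F i r.
Proof.
have B0 i : 0 < (2 ^ n) ^ i by rewrite !expn_gt0.
elim: k => [|k IH]; first by rewrite big_ord1 !big_ord0.
rewrite expnS (sum_ord_mul _ _ (fun u => \prod_(i < k.+1) F i (digit n u i))).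
rewrite big_ord_recr /= -IH big_distrr /=; apply: eq_bigr => q _.
rewrite big_distrl /=; apply: eq_bigr => v _; rewrite big_ord_recr /=; congr (_ * F k _).
  apply: eq_bigr => i _; congr (F i _); rewrite /digit.
  rewrite -[in q * _](subnK (ltnW (ltn_ord i))) expnD mulnA divnMDl //.
  by rewrite -(prednK (_ : 0 < k - i)) ?subn_gt0 // expnSr mulnA modnMDl.
by rewrite /digit divnMDl // divn_small // addn0 modn_small.
Qed.

Definition spanned_tree (k n u : nat) : set (seq bool) :=
  [set s | exists2 i, i < k & prefix s (bstr n (digit n u i))].

(** Arithmetic form of [spanned_tree]: the equation says that [z] is the number of the prefix of
    length [j] of the [i]-th string. *)
Definition in_spanned (k n u z : nat) : bool :=
  [exists i : 'I_k, [exists j : 'I_n.+1, z.+1 == 2 ^ j + digit n u i %% 2 ^ j]].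

Definition spanned_index (k n u : nat) : nat :=
  \sum_(z < 2 ^ n.+1) in_spanned k n u z * 2 ^ z.

Lemma in_spannedP k n u s : reflect (spanned_tree k n u s) (in_spanned k n u (strn s)).
Proof.
apply: (iffP existsP) => [[i /existsP [j /eqP E]]|[i ik]].
  exists i => //; have jn : j <= n by rewrite -ltnS.
  rewrite (_ : s = take j (bstr n (digit n u i))) ?prefix_take //.
  rewrite take_bstr ?digit_lt //; apply: strn_inj; apply: succn_inj.
  by rewrite strn_bstr.
move=> sp; have := size_prefix sp; rewrite size_bstr ?digit_lt // => sn.
exists (Ordinal ik); apply/existsP; exists (Ordinal (sn : size s < n.+1)) => /=.
move: sp; rewrite prefixE take_bstr ?digit_lt // => /eqP <-.
by rewrite strn_bstr size_bstr // ltn_mod expn_gt0.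
Qed.

(** Connects the abstract coding with arithmetic: through [h], the code of the tree spanned by a
    tuple becomes computable from [u]. *)
Lemma canonical_index_spanned k n u :
  canonical_index (spanned_tree k n u) = spanned_index k n u.
Proof.
have -> : spanned_tree k n u =
    [set` [seq str z | z <- iota 0 (2 ^ n.+1) & in_spanned k n u z]].
  apply/seteqP; split=> s /=.
    move=> sT; apply/mapP; exists (strn s); last by rewrite strnK.
    rewrite mem_filter mem_iota /=; apply/andP; split; first exact/in_spannedP.
    have [i _ /size_prefix] := sT; rewrite size_bstr ?digit_lt // => sn.
    have /andP[_ H] := strn_bounds s; have : 2 ^ (size s).+1 <= 2 ^ n.+1.
      by rewrite leq_exp2l.
    by rewrite add0n; lia.
  move=> /mapP [z]; rewrite mem_filter => /andP[Hz _] ->.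
  by apply/in_spannedP; rewrite strK.
rewrite /canonical_index -fsbig_seq; last first.
  by rewrite map_inj_uniq ?filter_uniq ?iota_uniq //; apply: can_inj strK.
rewrite big_map big_filter big_mkcond /spanned_index.
rewrite -(big_mkord predT (fun z => in_spanned k n u z * 2 ^ z)) /index_iota subn0.
by apply: eq_bigr => z _; rewrite strK; case: in_spanned; rewrite ?mul1n.
Qed.

Lemma calculable_spanned_index k a n u : calculable a n -> calculable a u ->
  calculable a (fun v => spanned_index k (n v) (u v)).
Proof.
move=> cn cu.
apply: (@calculable_sum a (fun z v => in_spanned k (n v) (u v) z * 2 ^ z)); last first.
  exact/(calculable_exp (calculable_const _ _))/calculable_succ.
apply: calculable_mul; last exact: calculable_exp (calculable_const _ _) (calculable_nth _ _).
apply: (@decidable_exists a.+1 (fun i w => [exists j : 'I_(n (behead w)).+1,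
  (nth 0 w 0).+1 == 2 ^ j + digit (n (behead w)) (u (behead w)) i %% 2 ^ j])); last first.
  exact: calculable_const.
have cn2 := calculable_behead (calculable_behead cn).
have cu2 := calculable_behead (calculable_behead cu).
apply: (@decidable_exists a.+2 (fun j w => (nth 0 (behead w) 0).+1 ==
    2 ^ j + digit (n (behead (behead w))) (u (behead (behead w))) (nth 0 w 0) %% 2 ^ j)); last first.
  exact: calculable_succ.
have c2j : calculable a.+3 (fun w => 2 ^ nth 0 w 0).
  exact: calculable_exp (calculable_const _ _) (calculable_nth _ _).
have cn3 := calculable_behead cn2; have cu3 := calculable_behead cu2.
have c2n := calculable_exp (calculable_const _ 2) cn3.
apply: decidable_eq.
  exact/calculable_succ/(calculable_behead (calculable_behead (calculable_nth a.+1 0))).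
apply: (calculable_add (c2j)); apply: calculable_mod (c2j).
apply: calculable_mod (c2n); apply: (calculable_div cu3).
apply: (calculable_exp c2n); exact: (calculable_behead (calculable_nth a.+2 0)).
Qed.

(** The integer part of $\log_2(z+1)$, written as a bounded count. *)
Definition string_length (z : nat) : nat := \sum_(i < z) (2 ^ i.+1 <= z.+1).

Lemma string_lengthE s : string_length (strn s) = size s.
Proof.
have /andP[H1 H2] := strn_bounds s.
have sz : size s <= strn s.
  by rewrite -ltnS; apply: leq_trans H1; apply: ltn_expl.
rewrite -[RHS](sum_ltn sz); apply: eq_bigr => i _; congr nat_of_bool.
apply/idP/idP => H.
  by rewrite -ltnS -(@ltn_exp2l 2) //; apply: leq_ltn_trans H2.
by apply: leq_trans H1; rewrite leq_exp2l.
Qed.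

Lemma calculable_string_length a z : calculable a z ->
  calculable a (fun v => string_length (z v)).
Proof.
move=> cz; apply: (@calculable_sum a (fun i v => 2 ^ i.+1 <= (z v).+1 : nat)) => //.
apply: decidable_leq; last exact/calculable_succ/calculable_behead.
apply: calculable_exp; first exact: calculable_const.
exact/calculable_succ/calculable_nth.
Qed.

(** * Avoiding deep classes *)

Lemma finite_class_prefixes P n : finite_set (class_prefixes P n).
Proof.
apply: (sub_finite_set _ (finite_strings n)) => _ [x _ <-].
by rewrite /= size_cprefix.
Qed.

(** The first [n] at which [w] reaches a threshold is a jump; a threshold above [w n0] forces it
    beyond [n0]. *)
Lemma ex_jump (w : nat -> nat) n0 J :
  (forall j, exists n, j <= w n) -> {homo w : i j / i <= j} ->
  exists n, [/\ n0 <= n, J <= w n & is_jump w n].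
Proof.
move=> unb w_homo; have ex : exists n, maxn J (w n0).+1 <= w n by apply: unb.
case: (ex_minnP ex) => n; rewrite geq_max => /andP[Jn n0n] Hmin; exists n; split => //.
  by rewrite leqNgt; apply/negP => /ltnW /w_homo; lia.
rewrite /is_jump; case: n Jn n0n Hmin => [//|n] Jn n0n Hmin /=.
rewrite ltnNge; apply/negP => wn.
by have := Hmin n; rewrite geq_max (leq_trans Jn wn) (leq_trans n0n wn) ltnn => /(_ isT).
Qed.

Lemma deep_extension (R : realType) U (m : seq bool -> R) e c P (T0 : pruned_tree) n0 :
  optimal_prefix_free U -> optimal_semimeasure m -> tree_coding e ->
  deep m P -> avoiding (deficient U c) T0 ->
  exists T : pruned_tree, [/\ avoiding (deficient U c) T,
    trunc_tree T n0 = trunc_tree T0 n0 & ~ tree_member e T P].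
Proof.
move=> optU optm he [g [comp_g [g_homo g_unb] deep_g]] av0; apply: contrapT => Hno.
have allP (T : pruned_tree) : avoiding (deficient U c) T ->
    trunc_tree T n0 = trunc_tree T0 n0 -> tree_member e T P.
  by move=> avT ET; apply: contrapT => H; apply: Hno; exists T.
have [[p comp_p sp] inj pre [h comp_h eh]] := he.
have p_ltn := coding_size_ltn he T0 sp.
have p_ge n : n <= p n.
  by elim: n => [//|n IH]; apply: leq_ltn_trans IH _; apply: p_ltn.
have p_homo : {homo p : i j / i <= j} by apply: ltnW_homo.
pose leaves := [seq r <- iota 0 (2 ^ n0) | `[< tree_set T0 (bstr n0 r) >]].
pose k := size leaves; pose leaf i := bstr n0 (nth 0 leaves i).
have leafT i : i < k -> tree_set T0 (leaf i) /\ size (leaf i) = n0.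
  move=> ik; have := mem_nth 0 ik; rewrite mem_filter mem_iota => /andP[/asboolP H1 H2].
  by split=> //; apply: size_bstr.
have leaf_ex s : tree_set T0 s -> size s = n0 -> exists2 i, i < k & leaf i = s.
  move=> Ts sn; have Hs : bstr n0 (bnum s) = s by rewrite -{1}sn bnumK.
  have Hin : bnum s \in leaves.
    rewrite mem_filter Hs mem_iota /= add0n; apply/andP; split; first exact/asboolP.
    by have := bnum_lt s; rewrite sn.
  by exists (index (bnum s) leaves); rewrite ?index_mem // /leaf nth_index.
pose good i n r := `[< exists y, [/\ forall j, ~ deficient U c (cprefix y j),
  cprefix y n0 = leaf i & cprefix y n = bstr n r] >].
have [K HK] : {K : nat -> nat & forall i, i < k -> forall n, n0 <= n ->
    2 ^ n <= 2 ^ K i * \sum_(r < 2 ^ n) good i n r}.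
  apply: (choice (P := fun i Ki => i < k -> forall n, n0 <= n ->
    2 ^ n <= 2 ^ Ki * \sum_(r < 2 ^ n) good i n r)) => i.
  have [ik|ik] := ltnP i k; last by exists 0.
  have [Tl sl] := leafT i ik; have [x [xl Hx]] := pruned_path Tl; rewrite sl in xl.
  have [Ki HKi] := incompressible_path_count n0 optU (fun n => av0 _ (Hx n)).
  exists Ki => _ n n0n; apply: leq_trans (HKi n n0n) _; by rewrite xl.
(* The good tuples have measure at least [2 ^- Kt] at every level from [n0] on, as the product of
   the bounds for the single leaves. *)
pose Kt := \sum_(i < k) K i.
have count n : n0 <= n -> 2 ^ (k * n) <=
    2 ^ Kt * \sum_(u < 2 ^ (k * n)) [forall i : 'I_k, good i n (digit n u i)].
  move=> n0n; have E : 2 ^ (k * n) = (2 ^ n) ^ k by rewrite mulnC expnM.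
  have -> : \sum_(u < 2 ^ (k * n)) ([forall i : 'I_k, good i n (digit n u i)] : nat) =
      \prod_(i < k) \sum_(r < 2 ^ n) good i n r.
    rewrite E -(sum_digits _ _ (fun i r => good i n r : nat)); apply: eq_bigr => u _.
    case: (boolP [forall i : 'I_k, good i n (digit n u i)]) => [/forallP H|/forallPn [i Hi]].
      by rewrite big1 // => i _; rewrite H.
    by rewrite (bigD1 i) //= (negPf Hi).
  rewrite E /Kt expn_sum -big_split /= -[in leqLHS](card_ord k) -prod_nat_const.
  by apply: leq_prod => i _; apply: HK.
(* Defined for all tuples, since goodness is not decidable; values on other tuples only add mass
   outside the argument. *)
pose code n u := h (spanned_index k n u).
have good_code n u : n0 <= n -> [forall i : 'I_k, good i n (digit n u i)] ->
    exists2 s, class_prefixes P (p n) s & strn s = code n u.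
  move=> n0n /forallP Hgood.
  have [y Hy] : {y : nat -> cantor_space & forall i, i < k ->
      [/\ forall j, ~ deficient U c (cprefix (y i) j),
        cprefix (y i) n0 = leaf i & cprefix (y i) n = bstr n (digit n u i)]}.
    apply: (choice (P := fun i (yi : cantor_space) => i < k ->
      [/\ forall j, ~ deficient U c (cprefix yi j),
        cprefix yi n0 = leaf i & cprefix yi n = bstr n (digit n u i)])) => i.
    have [ik|ik] := ltnP i k; last by exists (fun=> false).
    by have /asboolP [y Hy] := Hgood (Ordinal ik); exists y.
  (* These [k] paths alone form the tree: its truncation at [n] is [spanned_tree k n u], and it
     agrees with [T0] up to [n0] because every leaf lies on one of them. *)
  pose Y := [set y i | i in [set i | i < k]].
  have Y0 : Y !=set0.
    have [s Ts sn] := pruned_level T0 n0; have [i ik _] := leaf_ex s Ts sn.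
    by exists (y i), i.
  have avT : avoiding (deficient U c) (path_tree Y0).
    by move=> s [_ [i ik <-] <-]; have [H _ _] := Hy i ik.
  have ET : trunc_tree (path_tree Y0) n0 = trunc_tree T0 n0.
    apply/seteqP; split=> s [Ts sn]; split=> //.
      have [_ [i ik <-] <-] := Ts; have [_ E _] := Hy i ik.
      by rewrite -(take_cprefix _ sn) E; apply: tree_take; case: (leafT i ik).
    have [t [Tt tn <-]] := pruned_extend Ts sn.
    have [i ik <-] := leaf_ex t Tt tn; have [_ <- _] := Hy i ik.
    by rewrite take_cprefix //; apply: cprefix_path_tree; exists i.
  have [x Tx Px] := allP _ avT ET; exists (e (trunc_tree (path_tree Y0) n)).
    by rewrite Tx sp; exists x.
  rewrite eh /code -canonical_index_spanned; congr (h (canonical_index _)).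
  apply/seteqP; split=> s.
    move=> [[_ [i ik <-] <-]]; rewrite size_cprefix => sn; exists i => //.
    by have [_ _ <-] := Hy i ik; rewrite prefixE size_cprefix take_cprefix.
  move=> [i ik sp']; have := size_prefix sp'; rewrite size_bstr ?digit_lt // => sn.
  split=> //; exists (y i); first by exists i.
  by move: sp'; have [_ _ <-] := Hy i ik; rewrite prefixE take_cprefix // => /eqP.
(* For a string of length [p n], exactly the [i < n] satisfy [p i < p n], and [n <= p n] makes the
   range of the count long enough. *)
pose lvl z := \sum_(i < string_length z) (p i < string_length z).
have lvlE s n : size s = p n -> lvl (strn s) = n.
  move=> sn; rewrite /lvl string_lengthE sn -[RHS](sum_ltn (p_ge n)).
  apply: eq_bigr => i _; congr nat_of_bool.
  apply/idP/idP => [|/p_ltn //]; apply: contraTT; rewrite -!leqNgt; exact: p_homo.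
pose w n := (g (p n)) %/ 2.
have w_homo : {homo w : i j / i <= j} by move=> i j ij; apply/leq_div2r/g_homo/p_homo.
have w_unb j : exists n, j <= w n.
  have [n Hn] := g_unb (2 * j); exists n; rewrite leq_divRL // mulnC.
  exact/(leq_trans Hn)/g_homo/p_ge.
have c_g := (computable1P g).1 comp_g; have c_p := (computable1P p).1 comp_p.
have c_h := (computable1P h).1 comp_h.
have [||||C C0 HC] := @pushforward_le_optimal code lvl w (fun n => k * n) R m optm w_homo.
- apply: (calculable_comp1 c_h); apply: calculable_spanned_index; exact: calculable_nth.
- have c_len := calculable_string_length (calculable_nth 1 0).
  apply: (@calculable_sum 1 (fun i v => p i < string_length (nth 0 v 0) : nat)) => //.
  apply: decidable_leq; last exact: calculable_behead c_len.
  exact/calculable_succ/(calculable_comp1 c_p)/calculable_nth.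
- apply: calculable_div; last exact: calculable_const.
  exact/(calculable_comp1 c_g)/(calculable_comp1 c_p)/calculable_nth.
- exact: calculable_mul (calculable_const _ _) (calculable_nth _ _).
(* Chosen so that [C * 2 ^+ Kt.+1 < J <= w n < 2 ^+ w n]. *)
pose J := Num.bound (C * 2 ^+ Kt.+1)%R.
have [n [n0n Jn jump_n]] := ex_jump n0 J w_unb w_homo.
have lvlA s : class_prefixes P (p n) s -> lvl (strn s) = n.
  by move=> [x _ <-]; apply: lvlE; rewrite size_cprefix.
have := HC n _ jump_n (finite_class_prefixes P (p n)) lvlA.
set X := \sum_(u < _) _ => HX.
have HX2 : 2 ^ (k * n) <= 2 ^ Kt * X.
  apply: leq_trans (count n n0n) _; rewrite leq_mul2l; apply/orP; right.
  apply: leq_sum => u _; case: (boolP [forall i, _]) => // Hu.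
  by case: asboolP => // -[]; apply: good_code.
have {HX2} : ((2 ^ (k * n))%:R <= (2 ^ Kt * X)%:R :> R)%R by rewrite ler_nat.
apply/negP; rewrite -ltNge natrM !natrX.
(* Depth contributes [2 ^- g (p n)], at most [2 ^- w n] squared. One factor cancels the weight of
   the level; the other beats [C * 2 ^+ Kt.+1], contradicting the lower bound on the good tuples. *)
apply: (@le_lt_trans _ _ (2 ^+ Kt * (C * 2 ^+ ((w n).+1 + k * n) * 2 ^- g (p n))))%R.
  apply: ler_wpM2l; first by rewrite exprn_ge0.
  apply: le_trans HX _; apply: ler_wpM2l (deep_g (p n)).
  by rewrite mulr_ge0 ?exprn_ge0 // ltW.
have Hg : (2 ^- g (p n) <= 2 ^- w n * 2 ^- w n :> R)%R.
  rewrite -invfM -exprD lef_pV2 ?posrE ?exprn_gt0 // ler_weXn2l ?ler1n //.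
  by rewrite /w; lia.
have HJ : (C * 2 ^+ Kt.+1 < 2 ^+ w n :> R)%R.
  have H0 : (0 <= C * 2 ^+ Kt.+1 :> R)%R by rewrite mulr_ge0 ?exprn_ge0 // ltW.
  apply: lt_le_trans (archi_boundP H0) _; rewrite -/J -natrX ler_nat.
  exact: leq_trans Jn (ltnW (ltn_expl _ _)).
have W0 : (0 < 2 ^+ w n :> R)%R by rewrite exprn_gt0.
have N0 : (0 < 2 ^+ (k * n) :> R)%R by rewrite exprn_gt0.
apply: (@le_lt_trans _ _ ((C * 2 ^+ Kt.+1) / 2 ^+ w n * 2 ^+ (k * n)))%R.
  apply: le_trans (_ : _ <= 2 ^+ Kt * (C * 2 ^+ ((w n).+1 + k * n) * (2 ^- w n * 2 ^- w n)))%R _.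
    by rewrite !ler_wpM2l // ?mulr_ge0 ?exprn_ge0 // ltW.
  rewrite exprD !exprS; rewrite le_eqVlt; apply/orP; left; apply/eqP; field.
  exact: lt0r_neq0.
by rewrite -[ltRHS]mul1r ltr_pM2r // ltr_pdivrMr // mul1r.
Qed.

Definition ce_class (f : mu_code) : set cantor_space :=
  [set x | forall n, ~ exists y, mu_eval f [:: strn (cprefix x n)] y].

Lemma ce_class_pi01 f : pi01_class (ce_class f).
Proof. by exists [set s | exists y, mu_eval f [:: strn s] y] => //; exists f. Qed.

Lemma pi01_ce_class P : pi01_class P -> exists f, P = ce_class f.
Proof.
move=> [W [f Wf] ->]; exists f; by apply/seteqP; split=> x Hx n /Wf; apply: Hx.
Qed.

Local Open Scope ring_scope.

Theorem theorem1p9 (R : realType) (U : mu_code) (hU : optimal_prefix_free U)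
  (m : seq bool -> R) (hm : optimal_semimeasure m)
  (e : set (seq bool) -> seq bool) (he : tree_coding e) (c : nat) :
  comeager [set T : incompressible_trees R U c |
    is_perfect (val T) /\
    forall P : set cantor_space, pi01_class P -> deep m P ->
      ~ tree_member e (val T) P].
Proof.
have [codes codesP] := mu_code_enumeration.
pose S := incompressible_trees R U c.
have avS (T : S) : avoiding (deficient U c) (val T).
  by apply/is_incompressibleP; apply: set_mem (valP T).
have inS T : avoiding (deficient U c) (tree_set T) -> exists T' : S, val T' = T.
  by move/(@is_incompressibleP R) => ST; exists (SigSub (mem_set (ST : S T))).
pose split_at s := [set T : S | tree_set (val T) s -> splits (val T) s].
(* All codes are listed, whether or not their class is deep; for a class that is not deep the
   condition holds everywhere. *)
pose outside f := [set T : S | deep m (ce_class f) -> ~ tree_member e (val T) (ce_class f)].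
exists (fun n => if odd n then split_at (str n./2) else outside (codes n./2)); split.
  move=> n; case: (odd n); split.
  - exact: open_splits.
  - apply: dense_set_type_pruned_tree => T l.
    have [T' [/inS [T'' <-] ET spT]] := perfect_extension l hU (avS T).
    by exists T''; split=> // /spT.
  - rewrite /outside; case: (pselect (deep m (ce_class (codes n./2)))) => Hd.
      rewrite (_ : [set T : S | _] =
          [set T : S | ~ tree_member e (val T) (ce_class (codes n./2))]).
        exact/(open_not_tree_member he)/ce_class_pi01.
      by apply/seteqP; split=> T /=; [apply | move=> H _].
    rewrite (_ : [set T : S | _] = setT); first exact: openT.
    by apply/seteqP; split=> T // _ /= /Hd.
  - apply: dense_set_type_pruned_tree => T l.
    case: (pselect (deep m (ce_class (codes n./2)))) => Hd; last by exists T; split=> // /Hd.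
    have [T' [/inS [T'' <-] ET nT]] := deep_extension l hU hm he Hd (avS T).
    by exists T''; split.
move=> T HT; split.
  move=> s Ts; have := HT (strn s).*2.+1 I; rewrite /= odd_double /=.
  by rewrite uphalf_double strnK; apply.
move=> P /pi01_ce_class [f ->]; have [n <-] := codesP f => Hd.
by have := HT n.*2 I; rewrite odd_double doubleK; apply.
Qed.
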